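(* Let $\mathbf{k}$ be any field and let $\rho_1\colon \mathbb{A}^2_{\mathbf{k}}\hookrightarrow \mathrm{SL}_2$ be the closed embedding $(s,t)\mapsto \begin{pmatrix}1 & t\\ s & 1+st\end{pmatrix}$. Then an automorphism $(s,t)\mapsto (f(s,t),g(s,t))$ of $\mathbb{A}^2_{\mathbf{k}}$ extends to an automorphism of $\mathrm{SL}_2$, via $\rho_1$, if and only if its Jacobian determinant $\frac{\partial f}{\partial s}\frac{\partial g}{\partial t}-\frac{\partial f}{\partial t}\frac{\partial g}{\partial s}\in\mathbf{k}^*$ is equal to $\pm 1$. In particular, the following holds: (1) every closed embedding $\mathbb{A}^2_{\mathbf{k}}\hookrightarrow \mathrm{SL}_2$ with image $\rho_1(\mathbb{A}^2_{\mathbf{k}})$ is equivalent to an embedding $\rho_\lambda\colon \mathbb{A}^2_{\mathbf{k}}\hookrightarrow \mathrm{SL}_2$, $(s,t)\mapsto \begin{pmatrix}1 & t\\ \lambda s & 1+\lambda st\end{pmatrix}$, for a certain $\lambda\in\mathbf{k}^*$; moreover, for $\lambda,\lambda'\in\mathbf{k}^*$, the embeddings $\rho_\lambda$ and $\rho_{\lambda'}$ are equivalent if and only if $\lambda'=\pm\lambda$; (2) if $\mathbf{k}$ has at least $4$ elements, then not all automorphisms of $\mathbb{A}^2_{\mathbf{k}}$ extend to $\mathrm{SL}_2$ via $\rho_1$.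
   Context: Varieties, morphisms and automorphisms are over $\mathbf{k}$. $\mathrm{SL}_2=\operatorname{Spec}(\mathbf{k}[t,u,x,y]/(xy-tu-1))\subset\mathbb{A}^4_{\mathbf{k}}$, its points being written as matrices $\begin{pmatrix}x & t\\ u & y\end{pmatrix}$; $\operatorname{Aut}(\mathrm{SL}_2)$ denotes its automorphisms as an algebraic variety. Two closed embeddings $\rho,\rho'\colon X\hookrightarrow Y$ are equivalent if there is $\varphi\in\operatorname{Aut}(Y)$ with $\rho'=\varphi\circ\rho$. An automorphism $\beta$ of $X$ extends to $Y$ via a closed embedding $\rho\colon X\hookrightarrow Y$ if there is $\alpha\in\operatorname{Aut}(Y)$ with $\alpha\circ\rho=\rho\circ\beta$. *)

(* Defs.v *)
(* An affine k-scheme Spec A is represented by its coordinate ring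
   A : comAlgType k, and a morphism Spec A -> Spec B by its comorphism, a
   k-algebra morphism {lrmorphism B -> A}.  Composition is therefore reversed:
   if r, p are the comorphisms of rho, phi, then phi o rho has comorphism r \o p. *)
From HB Require Import structures.
From mathcomp Require Import all_boot all_algebra.
From mathcomp Require Import generic_quotient ring_quotient.
From mathcomp Require Import boolp.
From mathcomp Require Import mpoly.

Set Implicit Arguments.
Unset Strict Implicit.
Unset Printing Implicit Defensive.

Import GRing.Theory.
Local Open Scope ring_scope.
Local Open Scope quotient_scope.

Section AffineSchemes.
Variables (k : fieldType) (A B : comAlgType k).

Definition is_automorphism (C : comAlgType k) (phi : {lrmorphism C -> C}) : Prop :=
  exists psi : {lrmorphism C -> C}, cancel phi psi /\ cancel psi phi.

Definition closed_embedding (rho : {lrmorphism B -> A}) : Prop :=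
  forall a : A, exists b : B, rho b = a.

(* Set-theoretic image, as a set of points of Spec B: the primes of B
   contracted from primes of A along the comorphism. *)
Definition in_image (rho : {lrmorphism B -> A}) (Q : prime_idealr B) : Prop :=
  exists P : prime_idealr A, forall b : B, (b \in Q) = (rho b \in P).

Definition same_image (rho rho' : {lrmorphism B -> A}) : Prop :=
  forall Q : prime_idealr B, in_image rho Q <-> in_image rho' Q.

Definition equivalent (rho rho' : {lrmorphism B -> A}) : Prop :=
  exists phi : {lrmorphism B -> B},
    is_automorphism phi /\ rho' =1 rho \o phi.

Definition extends_via (rho : {lrmorphism B -> A}) (beta : {lrmorphism A -> A}) : Prop :=
  exists alpha : {lrmorphism B -> B},
    is_automorphism alpha /\ rho \o alpha =1 beta \o rho.

End AffineSchemes.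

(* The coordinates of A^2 are (s, t) = ('X_0, 'X_1). *)
Notation A2 k := {mpoly k[2]}.

Section Plane.
Variable k : fieldType.

Definition plane_end (f g : A2 k) : {lrmorphism A2 k -> A2 k} :=
  comp_mpoly [tuple f; g].

Definition jacobian (f g : A2 k) : A2 k :=
  mderiv 0 f * mderiv 1 g - mderiv 1 f * mderiv 0 g.

End Plane.

Section SL2.
Variable k : fieldType.

Definition pt : {mpoly k[4]} := 'X_(inord 0).
Definition pu : {mpoly k[4]} := 'X_(inord 1).
Definition px : {mpoly k[4]} := 'X_(inord 2).
Definition py : {mpoly k[4]} := 'X_(inord 3).

Definition sl2_rel : {mpoly k[4]} := px * py - pt * pu - 1.

(* [boolp] is used only here, to turn membership in the principal ideal into a
   boolean predicate. *)
Definition sl2_ideal : pred {mpoly k[4]} :=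
  fun p => `[< exists q, p = q * sl2_rel >].

Lemma sl2_idealP p : reflect (exists q, p = q * sl2_rel) (p \in sl2_ideal).
Proof. exact: asboolP. Qed.

Lemma comp_coords n (a b c d : {mpoly k[n]}) :
  [/\ pt \mPo [tuple a; b; c; d] = a, pu \mPo [tuple a; b; c; d] = b,
      px \mPo [tuple a; b; c; d] = c & py \mPo [tuple a; b; c; d] = d].
Proof. by split; rewrite comp_mpolyXU inordK. Qed.

Lemma comp_sl2_rel n (a b c d : {mpoly k[n]}) :
  sl2_rel \mPo [tuple a; b; c; d] = c * d - a * b - 1.
Proof.
have [Ea Eb Ec Ed] := comp_coords a b c d.
by rewrite /sl2_rel !rmorphB !rmorphM rmorph1 /= Ea Eb Ec Ed.
Qed.

Lemma sl2_ideal_closed : idealr_closed sl2_ideal.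
Proof.
split.
- by apply/sl2_idealP; exists 0; rewrite mul0r.
- apply/sl2_idealP => -[q] /(congr1 (comp_mpoly [tuple 0; 0; 1; 1 : A2 k])).
  rewrite rmorph1 rmorphM /= comp_sl2_rel mulr1 mulr0 subr0 subrr mulr0.
  exact/eqP/oner_neq0.
- move=> a u v /sl2_idealP [p ->] /sl2_idealP [q ->].
  by apply/sl2_idealP; exists (a * p + q); rewrite mulrDl mulrA.
Qed.

HB.instance Definition _ := isIdealr.Build {mpoly k[4]} sl2_ideal sl2_ideal_closed.

Definition sl2_idealr : idealr {mpoly k[4]} := sl2_ideal.

Definition SL2 := {ideal_quot sl2_idealr}.

HB.instance Definition _ := GRing.ComNzRing.on SL2.

Definition sl2_pi : {mpoly k[4]} -> SL2 := \pi_{ideal_quot sl2_idealr}.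

Lemma sl2_piB : zmod_morphism sl2_pi. Proof. exact: raddfB. Qed.
Lemma sl2_piM : monoid_morphism sl2_pi.
Proof. by split; [exact: rmorph1 | exact: rmorphM]. Qed.
HB.instance Definition _ := GRing.isZmodMorphism.Build _ _ sl2_pi sl2_piB.
HB.instance Definition _ := GRing.isMonoidMorphism.Build _ _ sl2_pi sl2_piM.

Lemma sl2_piK (q : SL2) : sl2_pi (repr q) = q. Proof. exact: reprK. Qed.

Lemma sl2_pi_eqP p q : reflect (sl2_pi p = sl2_pi q) (p - q \in sl2_ideal).
Proof. by rewrite (Quotient.idealrBE sl2_idealr p q); apply: eqP. Qed.

Definition sl2_scale (a : k) (q : SL2) : SL2 := sl2_pi a%:MP * q.

Fact sl2_scaleA a b v : sl2_scale a (sl2_scale b v) = sl2_scale (a * b) v.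
Proof. by rewrite /sl2_scale mulrA -rmorphM -mpolyCM. Qed.
Fact sl2_scale1 : left_id 1 sl2_scale.
Proof. by move=> v; rewrite /sl2_scale mpolyC1 rmorph1 mul1r. Qed.
Fact sl2_scaleDr : right_distributive sl2_scale +%R.
Proof. by move=> a u v; rewrite /sl2_scale mulrDr. Qed.
Fact sl2_scaleDl v : {morph sl2_scale^~ v : a b / a + b}.
Proof. by move=> a b; rewrite /sl2_scale mpolyCD rmorphD mulrDl. Qed.
HB.instance Definition _ := GRing.Zmodule_isLmodule.Build k SL2
  sl2_scaleA sl2_scale1 sl2_scaleDr sl2_scaleDl.

Fact sl2_scaleAl (a : k) (u v : SL2) : a *: (u * v) = a *: u * v.
Proof. exact: mulrA. Qed.
HB.instance Definition _ := GRing.Lmodule_isLalgebra.Build k SL2 sl2_scaleAl.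
HB.instance Definition _ := GRing.Lalgebra_isComAlgebra.Build k SL2.

Lemma sl2_piZ : scalable sl2_pi.
Proof. by move=> a p; rewrite -mul_mpolyC rmorphM. Qed.
HB.instance Definition _ :=
  GRing.isScalable.Build k {mpoly k[4]} SL2 *:%R sl2_pi sl2_piZ.

(* Values of (t, u, x, y) at the matrix (x, t; u, y) = (1, t; lam s, 1 + lam s t). *)
Definition rho_coords (lam : k) : 4.-tuple (A2 k) :=
  [tuple 'X_1; lam *: 'X_0; 1; 1 + lam *: ('X_0 * 'X_1)].

Definition rho_fun (lam : k) (q : SL2) : A2 k := repr q \mPo rho_coords lam.

Lemma rho_fun_pi lam p : rho_fun lam (sl2_pi p) = p \mPo rho_coords lam.
Proof.
have /sl2_pi_eqP/sl2_idealP[q Eq] := sl2_piK (sl2_pi p).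
apply/eqP; rewrite -subr_eq0 -rmorphB /= Eq rmorphM /= comp_sl2_rel.
by rewrite mul1r -scalerAr ['X_1 * _]mulrC addrK subrr mulr0.
Qed.

Fact rho_funB lam : zmod_morphism (rho_fun lam).
Proof.
by move=> p q; rewrite -[p]sl2_piK -[q]sl2_piK -rmorphB !rho_fun_pi rmorphB.
Qed.
Fact rho_funM lam : monoid_morphism (rho_fun lam).
Proof.
split=> [|p q]; first by rewrite -(rmorph1 sl2_pi) rho_fun_pi rmorph1.
by rewrite -[p]sl2_piK -[q]sl2_piK -rmorphM !rho_fun_pi rmorphM.
Qed.
Fact rho_funZ lam : scalable (rho_fun lam).
Proof. by move=> a p; rewrite -[p]sl2_piK -linearZ !rho_fun_pi linearZ. Qed.
HB.instance Definition _ lam :=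
  GRing.isZmodMorphism.Build SL2 (A2 k) (rho_fun lam) (rho_funB lam).
HB.instance Definition _ lam :=
  GRing.isMonoidMorphism.Build SL2 (A2 k) (rho_fun lam) (rho_funM lam).
HB.instance Definition _ lam :=
  GRing.isScalable.Build k SL2 (A2 k) *:%R (rho_fun lam) (rho_funZ lam).

Definition rho (lam : k) : {lrmorphism SL2 -> A2 k} := rho_fun lam.

Lemma rho_pi lam p : rho lam (sl2_pi p) = p \mPo rho_coords lam.
Proof. exact: rho_fun_pi. Qed.

Lemma rho_closed_embedding lam : lam != 0 -> closed_embedding (rho lam).
Proof.
move=> lam0 a.
exists (sl2_pi (a \mPo [tuple lam^-1 *: pu; pt])); rewrite rho_pi.
have [Et Eu _ _] := comp_coords 'X_1 (lam *: 'X_0) 1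
  (1 + lam *: ('X_0 * 'X_1) : A2 k).
elim/mpolyind: a => [|c m p _ _ IH]; first by rewrite !rmorph0.
rewrite !rmorphD /= IH; congr (_ + _); rewrite !linearZ /=; congr (_ *: _).
rewrite (mpolyXE_id _ m) !rmorph_prod.
apply: eq_bigr => i _; rewrite !rmorphXn /= comp_mpolyXU; congr (_ ^+ _).
case: i => -[|[|//]] lti /=.
  by rewrite linearZ /= Eu scalerA mulVf // scale1r; congr 'X_ _; apply: val_inj.
by rewrite Et; congr 'X_ _; apply: val_inj.
Qed.

End SL2.

(* Main.v *)
(* "Only if".  Let alpha be an automorphism of SL_2 extending an automorphism of
   the plane {x = 1}.  It maps x - 1 to c (x - 1), and fixes x because {x = 0}
   is the only fibre of x with nonconstant units.  The point is that alpha
   preserves k[x, t, u] in k[SL_2].  Otherwise alpha(t) = P / x^n with n > 0 and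
   P(0, t, u) a nonzero multiple of t u + 1.  Conjugating the G_a-action
   u -> u + x l, y -> y + t l by alpha gives a nontrivial G_a-action that fixes
   x and alpha(t).  Rescaling l by the smallest slope of its coefficients with
   respect to the x-adic order and reducing modulo x yields a nontrivial
   homomorphism k[t, u] -> k[t, u][l] that fixes P(0, t, u); comparing degrees
   in l, the images of t u + 1, and hence of t and u, do not involve l: a
   contradiction.  So alpha restricts to an automorphism of k[x][t, u]; its
   Jacobian is a constant c, which is the Jacobian at x = 1, while at x = 0 the
   curve t u = -1 is preserved, which forces an affine map of Jacobian 1 or -1.

   "If".  Affine maps of determinant 1 or -1 extend by row and column operations
   and transposition, so one may assume that (f, g) is the identity to first
   order at the origin.  Then f(x s, x t) / x and g(x s, x t) / x define
   automorphisms of k[x][s, t] that are the identity at x = 0 and (f, g) at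
   x = 1, and the former property makes them lift to SL_2. *)
From HB Require Import structures.
Require Import Defs.
From mathcomp Require Import all_boot all_algebra.
From mathcomp Require Import generic_quotient ring_quotient.
From mathcomp Require Import mpoly ring zify.

Set Implicit Arguments.
Unset Strict Implicit.
Unset Printing Implicit Defensive.

Import GRing.Theory.
Local Open Scope ring_scope.

(** * Homomorphisms from polynomial rings and a degeneration argument *)

Section PlaneHom.
Variable k : fieldType.

Lemma mpoly_gen_ind n (P : {mpoly k[n]} -> Prop) :
  (forall c, P c%:MP) -> (forall i, P 'X_i) ->
  (forall p q, P p -> P q -> P (p + q)) ->
  (forall p q, P p -> P q -> P (p * q)) -> forall p, P p.
Proof.
move=> PC PX PD PM.
have P1 : P 1 by rewrite -mpolyC1.
elim/mpolyind => [|c m p _ _ IH]; first by rewrite -mpolyC0.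
apply: PD => //; rewrite -mul_mpolyC; apply: (PM) => //.
rewrite mpolyXE_id; elim/big_ind: _ => // i _.
by elim: (m i) => [|d IHd]; [rewrite expr0|rewrite exprS; apply: PM].
Qed.

Lemma A2_ind (P : A2 k -> Prop) :
  (forall c, P c%:MP) -> P 'X_0 -> P 'X_1 ->
  (forall p q, P p -> P q -> P (p + q)) ->
  (forall p q, P p -> P q -> P (p * q)) -> forall p, P p.
Proof.
move=> PC P0 P1 PD PM; apply: mpoly_gen_ind => // -[[|[|//]] lti].
- by rewrite (_ : Ordinal lti = 0) //; apply: val_inj.
- by rewrite (_ : Ordinal lti = 1) //; apply: val_inj.
Qed.

(** The scalars enter through a ring morphism [i], so that targets such as [{poly {poly A2 k}}] or a
    fraction field need no [k]-algebra structure. *)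
Definition hom2 (A : comNzRingType) (i : {rmorphism k -> A}) (u t : A) :
  A2 k -> A := mmap i (tnth [tuple u; t]).

HB.instance Definition _ A i u t :=
  GRing.RMorphism.copy (@hom2 A i u t) (mmap i (tnth [tuple u; t])).

Lemma hom2C (A : comNzRingType) (i : {rmorphism k -> A})
    (u t : A) c : @hom2 A i u t c%:MP = i c.
Proof. exact: mmapC. Qed.

Lemma hom2X0 (A : comNzRingType) (i : {rmorphism k -> A})
    (u t : A) : @hom2 A i u t 'X_0 = u.
Proof. by rewrite /hom2 mmapX mmap1U. Qed.

Lemma hom2X1 (A : comNzRingType) (i : {rmorphism k -> A})
    (u t : A) : @hom2 A i u t 'X_1 = t.
Proof. by rewrite /hom2 mmapX mmap1U. Qed.

Lemma hom2_unique (A : comNzRingType) (i : {rmorphism k -> A})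
    (u t : A) (f : {rmorphism A2 k -> A}) :
  (forall c, f c%:MP = i c) -> f 'X_0 = u -> f 'X_1 = t -> f =1 @hom2 A i u t.
Proof.
move=> fC f0 f1; elim/A2_ind => [c|||p q Hp Hq|p q Hp Hq].
- by rewrite fC hom2C.
- by rewrite f0 hom2X0.
- by rewrite f1 hom2X1.
- by rewrite !rmorphD Hp Hq.
- by rewrite !rmorphM Hp Hq.
Qed.

Lemma hom2_comp (A B : comNzRingType) (i : {rmorphism k -> A})
    (i' : {rmorphism k -> B}) u t (f : {rmorphism A -> B}) p :
  (forall c, f (i c) = i' c) -> f (hom2 i u t p) = hom2 i' (f u) (f t) p.
Proof.
move=> fC; apply: (hom2_unique (f := f \o hom2 i u t)) => [c||] /=.
- by rewrite hom2C fC.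
- by rewrite hom2X0.
- by rewrite hom2X1.
Qed.

Lemma hom2_id p : hom2 (@mpolyC 2 k) 'X_0 'X_1 p = p.
Proof. by symmetry; apply: (hom2_unique (f := idfun)). Qed.

Definition homD (A : comNzRingType) (i : {rmorphism k -> A}) (u t x : A) :
  {poly A2 k} -> A := horner_morph (fun p => mulrC x (hom2 i u t p)).

HB.instance Definition _ A i u t x := GRing.RMorphism.copy (@homD A i u t x)
  (horner_morph (fun p => mulrC x (@hom2 A i u t p))).

Lemma homD_C (A : comNzRingType) (i : {rmorphism k -> A})
    (u t x : A) p : @homD A i u t x p%:P = hom2 i u t p.
Proof. exact: horner_morphC. Qed.

Lemma homD_X (A : comNzRingType) (i : {rmorphism k -> A})
    (u t x : A) : @homD A i u t x 'X = x.
Proof. exact: horner_morphX. Qed.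

Lemma polyX_ind (R : nzRingType) (P : {poly R} -> Prop) :
  (forall c, P c%:P) -> P 'X -> (forall p q, P p -> P q -> P (p + q)) ->
  (forall p q, P p -> P q -> P (p * q)) -> forall p, P p.
Proof.
move=> PC PX PD PM; elim/poly_ind => [|p c IH]; first exact: PC.
by apply: PD => //; apply: PM.
Qed.

Lemma homD_unique (A : comNzRingType) (i : {rmorphism k -> A})
    (u t x : A) (f : {rmorphism {poly A2 k} -> A}) :
  (forall c, f c%:MP%:P = i c) -> f ('X_0)%:P = u -> f ('X_1)%:P = t -> f 'X = x ->
  f =1 @homD A i u t x.
Proof.
move=> fC f0 f1 fx; elim/polyX_ind => [c||p q Hp Hq|p q Hp Hq].
- by rewrite homD_C; apply: (hom2_unique (f := f \o polyC)).
- by rewrite fx homD_X.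
- by rewrite !rmorphD Hp Hq.
- by rewrite !rmorphM Hp Hq.
Qed.

Lemma homD_comp (A B : comNzRingType) (i : {rmorphism k -> A})
    (i' : {rmorphism k -> B}) u t x (f : {rmorphism A -> B}) p :
  (forall c, f (i c) = i' c) ->
  f (homD i u t x p) = homD i' (f u) (f t) (f x) p.
Proof.
move=> fC; apply: (homD_unique (f := f \o homD i u t x)) => [c|||] /=.
- by rewrite homD_C hom2C fC.
- by rewrite homD_C hom2X0.
- by rewrite homD_C hom2X1.
- by rewrite homD_X.
Qed.

Lemma homD_congr (A : comNzRingType) (i : {rmorphism k -> A})
    (u t x u' t' x' : A) : u = u' -> t = t' -> x = x' ->
  homD i u t x =1 homD i u' t' x'.
Proof. by move=> -> -> ->. Qed.

Lemma homD_0 (A : comNzRingType) (i : {rmorphism k -> A})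
    (u t : A) p : @homD A i u t 0 p = hom2 i u t p.[0].
Proof.
symmetry; apply: (homD_unique (f := hom2 i u t \o horner_eval 0)) => [c|||] /=;
  by rewrite /horner_eval ?hornerX ?rmorph0 // hornerC (hom2C, hom2X0, hom2X1).
Qed.

End PlaneHom.

(** * Orders in [x] and smallest slopes *)

Section Slope.

(* The pairs [(n, i)] stand for the fractions [n / i]. *)
Lemma min_ratio (s : seq (nat * nat)) : (0 < size s)%N -> all (fun x => 0 < x.2)%N s ->
  exists2 x0, x0 \in s & forall x, x \in s -> (x0.1 * x.2 <= x.1 * x0.2)%N.
Proof.
elim: s => //= x s IH _ /andP[x0 s0].
case: s IH s0 => [_ _|y s IH s0].
  by exists x; rewrite ?mem_head // => z; rewrite inE => /eqP ->.
have [z zs Hz] := IH isT s0.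
have z0 := allP s0 _ zs.
have [le_xz|lt_zx] := leqP (x.1 * z.2) (z.1 * x.2).
  exists x; rewrite ?mem_head // => w; rewrite inE => /orP[/eqP -> //|ws].
  have := Hz w ws; have w0 := allP s0 _ ws; move: z0 w0 x0 le_xz => /=; nia.
exists z; first by rewrite inE zs orbT.
by move=> w; rewrite inE => /orP[/eqP ->|/Hz //]; apply: ltnW.
Qed.

Variable R : idomainType.

Lemma poly_ordX (p : {poly R}) :
  {n | exists2 q, p = q * 'X^n & p != 0 -> q.[0] != 0}.
Proof.
have [n H] := multiplicity_XsubC p 0; exists n; case: H => q Hq Ep.
exists q; first by rewrite {1}Ep subr0.
by move=> p0; have := implyP Hq p0; rewrite /root.
Qed.

(** The [x]-adic order; its value at [p = 0] is left unspecified. *)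
Definition ordX p : nat := sval (poly_ordX p).

Lemma ordXP p : exists2 q, p = q * 'X^(ordX p) & p != 0 -> q.[0] != 0.
Proof. exact: svalP (poly_ordX p). Qed.

Lemma comp_polyMX (A : comNzRingType) (p : {poly A}) c i :
  (p \Po (c%:P * 'X))`_i = p`_i * c ^+ i.
Proof.
rewrite comp_polyE (_ : \sum_(j < _) _ = \poly_(j < size p) (p`_j * c ^+ j)).
  rewrite coef_poly; case: ltnP => // /leq_sizeP -> //; first by rewrite mul0r.
rewrite poly_def; apply: eq_bigr => j _.
by rewrite exprMn -rmorphXn /= mul_polyC scalerA.
Qed.

End Slope.

Section Degeneration.
Variable k : fieldType.
Local Notation C := (A2 k).
Local Notation D := {poly C}.

(* After [x -> x^e] and [l -> l / x^a], where [a / e] is the smallest ratio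
   (x-order of the coefficient of [l^i]) / [i], the map given by [tt] and [uu]
   has a nontrivial reduction modulo [x]; the substitution [x -> x^e] avoids
   fractional exponents. *)
Lemma degenerate_factor (P : D) (tt uu : {poly D}) :
  tt`_0 = ('X_1)%:P -> uu`_0 = ('X_0)%:P ->
  ~~ ((size tt <= 1) && (size uu <= 1))%N ->
  homD (polyC \o polyC \o @mpolyC 2 k) uu tt 'X%:P P = P%:P ->
  forall Q, P.[0] = (1 + 'X_1 * 'X_0) * Q -> P.[0] = 0.
Proof.
move=> tt0 uu0 nontriv EP Q EQ.
(* The data for the slopes of [f]. The constant coefficient is left out, having no slope. *)
pose cf (f : {poly D}) := [seq (ordX f`_i, i) | i <- iota 1 (size f) & f`_i != 0].
have memcf (f : {poly D}) i : (0 < i)%N -> f`_i != 0 -> (ordX f`_i, i) \in cf f.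
  move=> i0 fi; apply/mapP; exists i => //; rewrite mem_filter fi mem_iota i0 /=.
  rewrite add1n ltnS ltnW //; apply: contraR fi.
  by rewrite -leqNgt => /leq_sizeP ->.
have cfP f x : x \in cf f -> [/\ (0 < x.2)%N, f`_x.2 != 0 & x.1 = ordX f`_x.2].
  by case/mapP => i; rewrite mem_filter mem_iota => /and3P[fi i0 _] ->.
have [||[a e] ae_in ae_min] := @min_ratio (cf tt ++ cf uu).
- move: nontriv; rewrite -has_predT has_cat.
  have big (f : {poly D}) : ~~ (size f <= 1)%N -> has predT (cf f).
    rewrite -ltnNge => sf; rewrite has_predT.
    have: (ordX f`_(size f).-1, (size f).-1) \in cf f.
      apply: memcf; first by lia.
      by rewrite -/(lead_coef f) lead_coef_eq0 -size_poly_gt0; lia.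
    by case: (cf f).
  by rewrite negb_and => /orP[] /big ->; rewrite ?orbT.
- by apply/allP => x; rewrite mem_cat => /orP[] /cfP[].
have e0 : (0 < e)%N by move: ae_in; rewrite mem_cat => /orP[] /cfP[].
pose th : {rmorphism D -> D} := comp_poly 'X^e.
(* The image of [f] under [x -> x^e], [l -> l / x^a]. Since [a / e] is the smallest slope,
   [drop_poly] divides exactly. *)
pose quo (f : {poly D}) := \poly_(i < size f) drop_poly (a * i) (th f`_i).
(* The substitution [l -> x^a l] undoes the division and is injective, so identities for [quo] can
   be checked after it. *)
pose La : {rmorphism {poly D} -> {poly D}} := comp_poly (('X^a)%:P * 'X).
have ordth (f : D) q n : f = q * 'X^n -> th f = th q * 'X^(e * n).
  by move=> ->; rewrite rmorphM /= rmorphXn /= comp_polyX exprM.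
have quoE (f : {poly D}) : {subset cf f <= cf tt ++ cf uu} -> La (quo f) = map_poly th f.
  move=> sub; apply/polyP => i; rewrite comp_polyMX coef_map coef_poly.
  case: ltnP => [_|/leq_sizeP ->//]; last by rewrite mul0r /= comp_poly0.
  rewrite -exprM.
  case: (posnP i) => [->|i0]; first by rewrite muln0 drop_poly0l mulr1.
  have [->|fi] := eqVneq f`_i 0; first by rewrite /= comp_poly0 drop_poly0r mul0r.
  have /ae_min /= := sub _ (memcf _ _ i0 fi).
  have [q Eq _] := ordXP f`_i; rewrite [in th _]Eq (ordth _ _ _ erefl).
  rewrite [(_ * e)%N]mulnC => le; rewrite -(subnK le).
  by rewrite exprD mulrA drop_polyMXn_id.
have La_inj : injective La.
  move=> p q /polyP E; apply/polyP => i; have := E i; rewrite !comp_polyMX.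
  by apply: mulIf; rewrite expf_neq0 // -size_poly_eq0 size_polyXn.
pose ev0 : {rmorphism {poly D} -> {poly C}} := map_poly (horner_eval 0).
pose i3 : {rmorphism k -> {poly D}} := polyC \o polyC \o @mpolyC 2 k.
pose i2 : {rmorphism k -> {poly C}} := polyC \o @mpolyC 2 k.
have Equo : homD i3 (quo uu) (quo tt) ('X^e)%:P P = (th P)%:P.
  apply: La_inj.
  have LaC c : La c%:P = c%:P by exact: comp_polyC.
  have Eu : La (quo uu) = map_poly th uu.
    by apply: quoE => x; rewrite mem_cat orbC => ->.
  have Et : La (quo tt) = map_poly th tt.
    by apply: quoE => x; rewrite mem_cat => ->.
  transitivity (homD i3 (La (quo uu)) (La (quo tt)) (La ('X^e)%:P) P).
    by apply: homD_comp => c; exact: LaC.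
  transitivity (homD i3 (map_poly th uu) (map_poly th tt) ('X^e)%:P P).
    exact: homD_congr Eu Et (LaC _) _.
  have thC c : map_poly th c%:P = (th c)%:P by exact: map_polyC.
  transitivity (map_poly th (homD i3 uu tt 'X%:P P)); last first.
    by rewrite EP thC LaC.
  have thx : map_poly th 'X%:P = ('X^e)%:P by rewrite thC [th 'X]comp_polyX.
  transitivity (homD i3 (map_poly th uu) (map_poly th tt) (map_poly th 'X%:P) P).
    exact: homD_congr erefl erefl (esym thx) _.
  symmetry; apply: homD_comp => c.
  by rewrite [LHS]thC; congr (_%:P); exact: comp_polyC.
(* Reduction modulo [x]: as [e > 0], the image [x^e] of [x] vanishes and only [P.[0]] is left of
   [P]. *)
have E0 : hom2 i2 (ev0 (quo uu)) (ev0 (quo tt)) P.[0] = P.[0]%:P.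
  rewrite -homD_0; move/(congr1 ev0): Equo.
  rewrite (homD_comp _ _ _ _ (f := ev0) (i' := i2)); last first.
    by move=> c; rewrite /= !map_polyC /= /horner_eval hornerC.
  rewrite /= !map_polyC /= /horner_eval horner_comp !hornerXn.
  by rewrite expr0n -[e]prednK.
have ev0c (f : {poly D}) i : (i < size f)%N ->
    (ev0 (quo f))`_i = (drop_poly (a * i) (th f`_i)).[0].
  by move=> lt; rewrite coef_map coef_poly lt.
have ev00 (f : {poly D}) : f`_0 != 0 -> (ev0 (quo f))`_0 = (f`_0).[0].
  move=> f0; rewrite ev0c.
    by rewrite muln0 drop_poly0l /= horner_comp hornerXn expr0n -[e]prednK.
  by rewrite lt0n size_poly_eq0; apply: contraNneq f0 => ->; rewrite coef0.
have X_neq0 (i : 'I_2) : 'X_i != 0 :> C by rewrite -msize_poly_eq0 msizeX.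
have t00 : (ev0 (quo tt))`_0 = 'X_1 by rewrite ev00 tt0 ?polyC_eq0 // hornerC.
have u00 : (ev0 (quo uu))`_0 = 'X_0 by rewrite ev00 uu0 ?polyC_eq0 // hornerC.
(* The smallest slope is attained at [l^e]: exactly the full power of [x] is removed from that
   coefficient, which therefore survives the reduction. *)
have big (f : {poly D}) : (a, e) \in cf f -> (1 < size (ev0 (quo f)))%N.
  case/cfP => /= _ fe Ea.
  have lte : (e < size f)%N.
    by rewrite ltnNge; apply: contra fe => /leq_sizeP ->.
  suff: (ev0 (quo f))`_e != 0.
    by apply: contraR; rewrite -leqNgt => /leq_sizeP ->.
  rewrite ev0c //; have [q Eq /(_ fe) q0] := ordXP f`_e.
  rewrite [in th _]Eq (ordth _ _ _ erefl) -Ea mulnC drop_polyMXn_id.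
  by rewrite /= horner_comp hornerXn expr0n -[e]prednK.
(* If [P.[0]] were nonzero, its factor [1 + t0 * u0] would have degree 0 in [l], hence so would [t0]
   and [u0], against [big]. *)
apply/eqP; apply: contraT => P0.
move: E0; rewrite {1}EQ rmorphM rmorphD rmorph1 rmorphM /= hom2X0 hom2X1.
set t0 := ev0 _ in t00 *; set u0 := ev0 _ in u00 *; move=> E0.
have szb : (1 < size t0)%N || (1 < size u0)%N.
  by move: ae_in; rewrite mem_cat => /orP[] /big H; apply/orP; [left|right].
change ((1 + t0 * u0) * hom2 i2 u0 t0 Q = (P.[0])%:P) in E0.
clearbody t0 u0.
have nz : (1 + t0 * u0) * hom2 i2 u0 t0 Q != 0 by rewrite E0 polyC_eq0.
have: size ((1 + t0 * u0) * hom2 i2 u0 t0 Q) = 1 by rewrite E0 size_polyC P0.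
move: nz; rewrite mulf_eq0 negb_or => /andP[n1 n2]; rewrite size_mul //.
move: n1 n2; rewrite -!size_poly_gt0 => n1 n2 sz.
have {}sz : (size (1 + t0 * u0)%R <= 1)%N.
  by move: n1 n2 sz; case: (size _) => [|[|a']] //; case: (size _) => // b' _ _; rewrite addnS.
have t0n : t0 != 0 by apply: contraNneq (X_neq0 1) => E; rewrite -t00 E coef0.
have u0n : u0 != 0 by apply: contraNneq (X_neq0 0) => E; rewrite -u00 E coef0.
have: (size (t0 * u0)%R <= 1)%N.
  rewrite -[t0 * u0](addKr 1); apply: leq_trans (size_polyD _ _) _.
  by rewrite size_polyN size_poly1 geq_max sz.
rewrite size_mul // => sztu.
move: t0n u0n szb sztu; rewrite -!size_poly_gt0.
by case: (size t0) => [|[|a']]; case: (size u0) => [|[|b']]; rewrite // ?addnS ?addSn.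
Qed.

End Degeneration.

(** * The coordinate ring of SL2 *)

Lemma mulr_reg_exp (R : nzRingType) (x : R) :
  (forall f, x * f = 0 -> f = 0) -> forall n f, x ^+ n * f = 0 -> f = 0.
Proof.
move=> reg; elim=> [|n IH] f; first by rewrite mul1r.
by rewrite exprS -mulrA => /reg/IH.
Qed.

Section SL2Ring.
Variable k : fieldType.
Local Notation O := (SL2 k).
Local Notation C := (A2 k).
Local Notation D := {poly C}.

Definition sc : {rmorphism k -> O} := @sl2_pi k \o @mpolyC 4 k.
Definition st : O := sl2_pi (pt k).
Definition su : O := sl2_pi (pu k).
Definition sx : O := sl2_pi (px k).
Definition sy : O := sl2_pi (py k).

Lemma sl2_alg (c : k) : c%:A = sc c :> O.
Proof. exact: mulr1. Qed.

Lemma scale_sc (c : k) (f : O) : c *: f = sc c * f.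
Proof. by []. Qed.

Lemma sxy : sx * sy = st * su + 1.
Proof.
apply/eqP; rewrite -subr_eq0 opprD addrA.
have /sl2_pi_eqP : sl2_rel k - 0 \in sl2_ideal (k := k).
  by apply/sl2_idealP; exists 1; rewrite subr0 mul1r.
by rewrite /sl2_rel !rmorphB !rmorphM rmorph1 rmorph0 => ->.
Qed.

Lemma ord4P (i : 'I_4) :
  [\/ i = inord 0, i = inord 1, i = inord 2 | i = inord 3].
Proof.
case: i => -[|[|[|[|//]]]] lti;
  [apply: Or41|apply: Or42|apply: Or43|apply: Or44];
  by apply: val_inj; rewrite /= inordK.
Qed.

Lemma SL2_ind (P : O -> Prop) :
  (forall c, P (sc c)) -> P st -> P su -> P sx -> P sy ->
  (forall p q, P p -> P q -> P (p + q)) ->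
  (forall p q, P p -> P q -> P (p * q)) -> forall p, P p.
Proof.
move=> PC Pt Pu Px Py PD PM f; rewrite -[f]sl2_piK.
elim/mpoly_gen_ind: (repr f) => [c|i|p q Hp Hq|p q Hp Hq].
- exact: PC.
- by case: (ord4P i) => ->.
- by rewrite rmorphD; apply: PD.
- by rewrite rmorphM; apply: PM.
Qed.

Lemma SL2_hom_eq (A : comNzRingType) (f g : {rmorphism O -> A}) :
  (forall c, f (sc c) = g (sc c)) -> f st = g st -> f su = g su ->
  f sx = g sx -> f sy = g sy -> f =1 g.
Proof.
move=> fC ft fu fx fy; elim/SL2_ind => // [p q Hp Hq|p q Hp Hq].
- by rewrite !rmorphD Hp Hq.
- by rewrite !rmorphM Hp Hq.
Qed.

Section Hom.
Variables (A : comNzRingType) (i : {rmorphism k -> A}) (t u x y : A).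

(** The universal property of [k[SL2]]. The relation is an argument, so that the morphism structure
    can be attached to [homO E]: evaluating a representative respects products only under it. *)
Definition homO of x * y = t * u + 1 :=
  fun f : O => mmap i (tnth [tuple t; u; x; y]) (repr f).

Hypothesis E : x * y = t * u + 1.

Lemma homO_pi p : homO E (sl2_pi p) = mmap i (tnth [tuple t; u; x; y]) p.
Proof.
have /sl2_pi_eqP/sl2_idealP[q Eq] := sl2_piK (sl2_pi p).
apply/eqP; rewrite -subr_eq0 -rmorphB /= Eq rmorphM /sl2_rel !rmorphB !rmorphM.
rewrite rmorph1 /= !mmapX !mmap1U !(tnth_nth 0) !inordK //= E.
by rewrite [_ + 1]addrC addrK subrr mulr0.
Qed.

Fact homO_zmod : zmod_morphism (homO E).
Proof. by move=> p q; rewrite -[p]sl2_piK -[q]sl2_piK -rmorphB !homO_pi rmorphB. Qed.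
Fact homO_monoid : monoid_morphism (homO E).
Proof.
split=> [|p q]; first by rewrite -(rmorph1 (@sl2_pi k)) homO_pi rmorph1.
by rewrite -[p]sl2_piK -[q]sl2_piK -rmorphM !homO_pi rmorphM.
Qed.
HB.instance Definition _ := GRing.isZmodMorphism.Build O A (homO E) homO_zmod.
HB.instance Definition _ := GRing.isMonoidMorphism.Build O A (homO E) homO_monoid.

Lemma homO_c c : homO E (sc c) = i c.
Proof. by rewrite homO_pi mmapC. Qed.
Lemma homO_t : homO E st = t.
Proof. by rewrite homO_pi mmapX mmap1U (tnth_nth 0) !inordK. Qed.
Lemma homO_u : homO E su = u.
Proof. by rewrite homO_pi mmapX mmap1U (tnth_nth 0) !inordK. Qed.
Lemma homO_x : homO E sx = x.
Proof. by rewrite homO_pi mmapX mmap1U (tnth_nth 0) !inordK. Qed.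
Lemma homO_y : homO E sy = y.
Proof. by rewrite homO_pi mmapX mmap1U (tnth_nth 0) !inordK. Qed.

Definition homOE := (homO_c, homO_t, homO_u, homO_x, homO_y).
End Hom.

(* The comorphism of [(x, t, u) : SL2 -> A^3]: here [{poly A2 k}] is
   [k[u, t][x]], with [u = 'X_0], [t = 'X_1] and [x = 'X]. *)
Definition jD : {rmorphism D -> O} := homD sc su st sx.

Lemma jDC c : jD c%:MP%:P = sc c. Proof. by rewrite /jD /= homD_C hom2C. Qed.
Lemma jD0 : jD ('X_0)%:P = su. Proof. by rewrite /jD /= homD_C hom2X0. Qed.
Lemma jD1 : jD ('X_1)%:P = st. Proof. by rewrite /jD /= homD_C hom2X1. Qed.
Lemma jDX : jD 'X = sx. Proof. by rewrite /jD /= homD_X. Qed.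

(** The relation gives [x y] as a polynomial in [t] and [u]; sums and products only need a common
    power of [x]. *)
Lemma clear_sx f : exists n, exists F, sx ^+ n * f = jD F.
Proof.
elim/SL2_ind: f => [c||||| p q [n [F EF]] [m [G EG]] | p q [n [F EF]] [m [G EG]]].
- by exists 0%N, (c%:MP%:P); rewrite mul1r jDC.
- by exists 0%N, ('X_1)%:P; rewrite mul1r jD1.
- by exists 0%N, ('X_0)%:P; rewrite mul1r jD0.
- by exists 0%N, 'X; rewrite mul1r jDX.
- exists 1%N, (('X_1)%:P * ('X_0)%:P + 1).
  by rewrite expr1 sxy rmorphD rmorphM rmorph1 jD1 jD0.
- exists (n + m)%N, ('X^m * F + 'X^n * G).
  rewrite rmorphD !rmorphM !rmorphXn -EF -EG jDX mulrDr !mulrA -!exprD.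
  by rewrite [(m + n)%N]addnC.
- exists (n + m)%N, (F * G).
  by rewrite rmorphM -EF -EG exprD mulrACA.
Qed.

(** If [x p = q (x y - t u - 1)], setting [x = 0] gives [0 = q(x = 0) (- t u - 1)], so [x] divides
    [q] and can be cancelled. *)
Lemma sx_reg f : sx * f = 0 -> f = 0.
Proof.
rewrite -[f]sl2_piK -rmorphM -(rmorph0 (@sl2_pi k)) => /sl2_pi_eqP.
rewrite subr0; set p := repr f => /sl2_idealP[q Eq].
have [E0 E1 E2 E3] := comp_coords (pt k) (pu k) 0 (py k).
have [r Er] : exists r, q = q \mPo [tuple pt k; pu k; 0; py k] + px k * r.
  elim/mpoly_gen_ind: q {Eq} => [c|i|p1 p2 [r1 Er1] [r2 Er2]|p1 p2 [r1 Er1] [r2 Er2]].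
  - by exists 0; rewrite mulr0 addr0 comp_mpolyC.
  - case: (ord4P i) => ->; [rewrite E0|rewrite E1|rewrite E2|rewrite E3].
    1,2,4: by exists 0; rewrite mulr0 addr0.
    by exists 1; rewrite mulr1 add0r.
  - by exists (r1 + r2); rewrite {1}Er1 {1}Er2 rmorphD mulrDr addrACA.
  - exists (r1 * (p2 \mPo [tuple pt k; pu k; 0; py k]) + p1 * r2).
    by rewrite {1}Er2 mulrDr rmorphM /= {1}Er1; ring.
have q0 : q \mPo [tuple pt k; pu k; 0; py k] = 0.
  move/(congr1 (comp_mpoly [tuple pt k; pu k; 0; py k])): Eq.
  rewrite !rmorphM /= E2 mul0r comp_sl2_rel mul0r sub0r => /esym/eqP.
  rewrite mulf_eq0 => /orP[/eqP //|/eqP/(congr1 (meval (fun _ => 0)))].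
  rewrite rmorphB rmorphN rmorphM /= !mevalXU rmorph1 rmorph0 mul0r oppr0 sub0r.
  by move=> /eqP; rewrite oppr_eq0 oner_eq0.
have px0 : px k != 0 by rewrite -msize_poly_eq0 msizeX.
apply/sl2_pi_eqP/sl2_idealP; exists r; rewrite subr0.
by apply: (mulfI px0); rewrite Eq {1}Er q0 add0r mulrA.
Qed.

Local Notation F := {fraction D}.

Definition fracC : {rmorphism k -> F} := @tofrac D \o polyC \o @mpolyC 2 k.

Fact locE : tofrac ('X : D) *
    ((1 + tofrac (('X_1)%:P : D) * tofrac (('X_0)%:P : D)) / tofrac ('X : D)) =
  tofrac (('X_1)%:P : D) * tofrac (('X_0)%:P : D) + 1.
Proof. by rewrite mulrC divfK ?tofrac_eq0 ?polyX_eq0 // addrC. Qed.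

(* Inverting [x] turns [SL2] into [{x != 0}] in [A^3], with [y = (1 + t u) / x]. *)
Definition loc : {rmorphism O -> F} := homO fracC locE.

Lemma loc_j P : loc (jD P) = tofrac P.
Proof.
rewrite /jD (homD_comp (i' := fracC)); last by move=> c; rewrite /loc /= homO_c.
symmetry; apply: (homD_unique (f := @tofrac D)) => [c|||].
- by [].
- exact: esym (homO_u _ _).
- exact: esym (homO_t _ _).
- exact: esym (homO_x _ _).
Qed.

Lemma jD_inj : injective jD.
Proof. by move=> p q /(congr1 loc); rewrite !loc_j => /eqP; rewrite tofrac_eq => /eqP. Qed.

Lemma sx_neq0 : sx != 0.
Proof. by rewrite -jDX -(rmorph0 jD) (inj_eq jD_inj) polyX_eq0. Qed.

Lemma sxn_reg n f : sx ^+ n * f = 0 -> f = 0.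
Proof. exact: mulr_reg_exp sx_reg n f. Qed.

Lemma sl2_domain (f g : O) : f * g = 0 -> f = 0 \/ g = 0.
Proof.
have [n [P EP]] := clear_sx f; have [m [Q EQ]] := clear_sx g => fg.
have : jD (P * Q) = 0 by rewrite rmorphM -EP -EQ mulrACA fg mulr0.
move/(congr1 loc); rewrite loc_j rmorph0 => /eqP; rewrite tofrac_eq0 mulf_eq0.
case/orP => /eqP E; [left; apply: (@sxn_reg n)|right; apply: (@sxn_reg m)].
- by rewrite EP E rmorph0.
- by rewrite EQ E rmorph0.
Qed.

Lemma sl2_mulfI (f : O) : f != 0 -> injective ( *%R f).
Proof.
move=> f0 g h /eqP; rewrite -subr_eq0 -mulrBr => /eqP /sl2_domain[E|/eqP].
- by rewrite E eqxx in f0.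
- by rewrite subr_eq0 => /eqP.
Qed.

Definition ratT : {fraction {poly k}} := tofrac 'X.
Definition ratC : {rmorphism k -> {fraction {poly k}}} := @tofrac {poly k} \o polyC.

Lemma ratT_neq0 : ratT != 0.
Proof. by rewrite tofrac_eq0 polyX_eq0. Qed.

(* Restriction to the curve [t u = -1], parametrized by [t]. *)
Definition curve : {rmorphism C -> {fraction {poly k}}} := hom2 ratC (- ratT^-1) ratT.

Lemma curveC c : curve c%:MP = ratC c. Proof. exact: hom2C. Qed.
Lemma curve0 : curve 'X_0 = - ratT^-1. Proof. exact: hom2X0. Qed.
Lemma curve1 : curve 'X_1 = ratT. Proof. exact: hom2X1. Qed.

(** Modulo [1 + t u] the inverse of [t] is [- u], so some [t^n p] is congruent to a polynomial [q]
    in [t] alone. On the curve [t] is transcendental, hence [q = 0]; multiplying by [u^n] and using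
    that [(t u)^n] is congruent to [(-1)^n] recovers [p]. *)
Lemma curve_ideal p : curve p = 0 -> exists q, p = (1 + 'X_1 * 'X_0) * q.
Proof.
move=> Ep.
pose inT : {rmorphism {poly k} -> C} := horner_morph (fun p => mulrC 'X_1 (@mpolyC 2 k p)).
have inTX : inT 'X = 'X_1 by exact: horner_morphX.
have inTC c : inT c%:P = c%:MP by exact: horner_morphC.
have [n [q [r Er]]] : exists n, exists q : {poly k}, exists r,
    'X_1 ^+ n * p = inT q + (1 + 'X_1 * 'X_0) * r.
  elim/A2_ind: p {Ep} => [c|||p q [n [q1 [r1 E1]]] [m [q2 [r2 E2]]]|
    p q [n [q1 [r1 E1]]] [m [q2 [r2 E2]]]].
  - by exists 0%N, c%:P, 0; rewrite inTC mul1r mulr0 addr0.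
  - by exists 1%N, (-1), 1; rewrite rmorphN rmorph1; ring.
  - by exists 0%N, 'X, 0; rewrite inTX mul1r mulr0 addr0.
  - exists (n + m)%N, ('X^m * q1 + 'X^n * q2), ('X_1 ^+ m * r1 + 'X_1 ^+ n * r2).
    rewrite rmorphD !rmorphM !rmorphXn inTX exprD.
    by ring: E1 E2.
  - exists (n + m)%N, (q1 * q2), (inT q1 * r2 + 'X_1 ^+ m * q * r1).
    by rewrite rmorphM exprD; ring: E1 E2.
have q0 : q = 0.
  move/(congr1 curve): Er; rewrite rmorphM Ep mulr0 rmorphD rmorphM rmorphD rmorphM.
  rewrite rmorph1 curve0 curve1 mulrN mulfV ?ratT_neq0 // subrr mul0r addr0.
  have -> : curve (inT q) = tofrac q.
    elim/polyX_ind: q  => [c||p1 p2 Hp Hq|p1 p2 Hp Hq].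
    - by rewrite inTC curveC.
    - by rewrite inTX curve1.
    - by rewrite !rmorphD Hp Hq.
    - by rewrite !rmorphM Hp Hq.
  by move/esym/eqP; rewrite tofrac_eq0 => /eqP.
move: Er; rewrite q0 rmorph0 add0r => Er.
have [s Es] : exists s, ('X_1 * 'X_0) ^+ n = (-1) ^+ n + (1 + 'X_1 * 'X_0) * s :> C.
  elim: {Er} n => [|n [s Es]]; first by exists 0; rewrite !expr0 mulr0 addr0.
  by exists ((-1) ^+ n + 'X_1 * 'X_0 * s); rewrite !exprS Es; ring.
exists ((-1) ^+ n * ('X_0 ^+ n * r - s * p)).
have sq : (-1) ^+ n * (-1) ^+ n = 1 :> C by rewrite -exprMn mulrNN mulr1 expr1n.
rewrite exprMn in Es.
rewrite -[LHS]mul1r -[in LHS]sq; clear -Er Es.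
move: ((-1) ^+ n : C) ('X_0 ^+ n : C) ('X_1 ^+ n : C) (1 + 'X_1 * 'X_0 : C)
  Er Es => e a b c Er Es.
have -> : c * (e * (a * r - s * p)) = e * (a * (c * r)) - e * (c * s) * p by ring.
rewrite -Er (_ : c * s = b * a - e); first by ring.
by rewrite Es addrC addKr.
Qed.

End SL2Ring.

(** * Fibres of x and additive group actions *)

Lemma shear_rel (R : comNzRingType) (t u x y : R) : x * y = t * u + 1 ->
  x%:P * (y%:P + t%:P * 'X) = t%:P * (u%:P + x%:P * 'X) + 1.
Proof.
move=> E; rewrite !mulrDr -!polyCM E polyCD !mulrA -!polyCM [x * t]mulrC.
exact: addrAC.
Qed.

Lemma shear_coef1 (R : comNzRingType) (u x : R) : (u%:P + x%:P * 'X)`_1 = x.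
Proof. by rewrite coefD coefC coefCM coefX mulr1 add0r. Qed.

Section Fibration.
Variable k : fieldType.
Local Notation O := (SL2 k).
Local Notation C := (A2 k).
Local Notation D := {poly C}.
Local Notation sc := (@sc k).
Local Notation st := (@st k).
Local Notation su := (@su k).
Local Notation sx := (@sx k).
Local Notation sy := (@sy k).
Local Notation jD := (@jD k).

Fact zero_fibreE : 0 * 0 = ratT k * - (ratT k)^-1 + 1.
Proof. by rewrite mulrN mulfV ?ratT_neq0 // mulr0 addNr. Qed.

(* The fibre [x = 0] is [{t u = -1} x A^1]; only its section [y = 0] is needed. *)
Definition zero_fibre : {rmorphism O -> {fraction {poly k}}} :=
  homO (@ratC k) zero_fibreE.

Lemma zero_fibre_x : zero_fibre sx = 0. Proof. exact: homO_x. Qed.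
Lemma zero_fibre_t : zero_fibre st = ratT k. Proof. exact: homO_t. Qed.
Lemma zero_fibre_c c : zero_fibre (sc c) = ratC k c. Proof. exact: homO_c. Qed.

Lemma zero_fibre_j P : zero_fibre (jD P) = curve k P.[0].
Proof.
transitivity (homD (@ratC k) (- (ratT k)^-1) (ratT k) 0 P); last exact: homD_0.
rewrite (homD_comp (i' := @ratC k)) => [|c]; last exact: zero_fibre_c.
apply: homD_congr; [exact: homO_u|exact: homO_t|exact: homO_x].
Qed.

(** More elements are divisible by [x] in [k[SL2]] than in [k[u, t][x]], for instance
    [t u + 1 = x y]; restriction to the curve [t u = -1] in the fibre [x = 0] controls the
    excess. *)
Lemma zero_fibre_dvd f P : sx * f = jD P -> exists q, P.[0] = (1 + 'X_1 * 'X_0) * q.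
Proof.
move=> E; apply: curve_ideal.
by rewrite -zero_fibre_j -E rmorphM zero_fibre_x mul0r.
Qed.

Lemma sx_nonunit f : sx * f <> 1.
Proof.
move/(congr1 zero_fibre); rewrite rmorphM zero_fibre_x mul0r rmorph1 => /esym/eqP.
by rewrite oner_eq0.
Qed.

(** After splitting off powers of the variable, the cofactors do not vanish at 0. Evaluating at 0
    forces the exponents to add up to [N], and the cofactors are then mutually inverse. *)
Lemma dvd_polyXn (R : idomainType) (p q : {poly R}) N : p * q = 'X^N ->
  exists a, exists2 c, c \is a GRing.unit & p = c%:P * 'X^a.
Proof.
move=> E.
have N0 : 'X^N != 0 :> {poly R} by rewrite -size_poly_eq0 size_polyXn.
have /andP[p0 q0] : (p != 0) && (q != 0) by rewrite -negb_or -mulf_eq0 E.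
have [p' Ep /(_ p0) p'0] := ordXP p; have [q' Eq /(_ q0) q'0] := ordXP q.
set a := ordX p in Ep; set b := ordX q in Eq.
have Xreg n : injective (fun r : {poly R} => r * 'X^n).
  by apply: mulIf; rewrite -size_poly_eq0 size_polyXn.
have pq : p' * q' = 1.
  have {}E : p' * q' * 'X^(a + b) = 'X^N by rewrite -E Ep Eq exprD mulrACA.
  have [lt|lt|eqN] := ltngtP (a + b)%N N.
  - have : p' * q' = 'X^(N - (a + b)).
      by apply: (@Xreg (a + b)%N); rewrite /= E -exprD subnK // ltnW.
    move/(congr1 (horner^~ 0)); rewrite hornerM hornerXn expr0n subn_eq0 leqNgt lt.
    by move/eqP; rewrite mulf_eq0 (negPf p'0) (negPf q'0).
  - have : p' * q' * 'X^(a + b - N) = 1.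
      by apply: (@Xreg N); rewrite /= mul1r -(mulrA (p' * q')) -exprD subnK // ltnW.
    move/(congr1 (horner^~ 0)); rewrite !hornerM hornerXn expr0n subn_eq0 leqNgt lt.
    by rewrite mulr0 hornerC => /esym/eqP; rewrite oner_eq0.
  - by apply: (@Xreg N); rewrite /= mul1r -{2}E eqN.
exists a; rewrite [p]Ep.
have : p' \is a GRing.unit by apply/unitrP; exists q'; rewrite mulrC.
rewrite poly_unitE => /andP[/size_poly1P[c c0 ->]]; rewrite coefC eqxx => uc.
by exists c.
Qed.

(** Clearing denominators turns a unit into a divisor of a power of [x] in [k[u, t][x]], so it is a
    scalar times a power of [x]. A nonzero exponent would make [x] invertible, but the fibre [x = 0]
    is not empty. *)
Lemma sl2_unit (e e' : O) : e * e' = 1 -> exists2 c, c != 0 & e = sc c.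
Proof.
move=> ee; have [n [P EP]] := clear_sx e; have [m [Q EQ]] := clear_sx e'.
have PQ : P * Q = 'X^(n + m).
  apply: jD_inj; rewrite rmorphM -EP -EQ mulrACA ee mulr1 -exprD.
  by rewrite rmorphXn jDX.
have [a [c uc Ec]] := dvd_polyXn PQ.
have [c0 c00 Ec0] : exists2 c0 : k, c0 != 0 & c = c0%:MP.
  have /unitrP[d [_ cd]] := uc.
  have := mpoly_intro_unit cd; have := mpoly_intro_unit (etrans (mulrC d c) cd).
  by case/andP=> /eqP Ec0 uc0 _; exists c@_0; rewrite -?unitfE.
exists c0 => //.
have {}EP : sx ^+ n * e = sc c0 * sx ^+ a.
  by rewrite EP Ec rmorphM rmorphXn jDX Ec0 jDC.
have xreg i f g : sx ^+ i * f = sx ^+ i * g -> f = g.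
  move=> /eqP; rewrite -subr_eq0 -mulrBr => /eqP/sxn_reg/eqP.
  by rewrite subr_eq0 => /eqP.
have cinv : sc c0 * sc c0^-1 = 1 by rewrite -rmorphM mulfV // rmorph1.
have [lt|lt|eqN] := ltngtP a n.
- have : sx ^+ (n - a) * e = sc c0.
    apply: (xreg a); rewrite mulrA -exprD addnC subnK; last exact: ltnW.
    by rewrite EP mulrC.
  move=> E; case: (@sx_nonunit (sx ^+ (n - a).-1 * e * sc c0^-1)).
  by rewrite !mulrA -exprS prednK ?subn_gt0 // E.
- have E : e = sc c0 * sx ^+ (a - n).
    apply: (xreg n); rewrite EP mulrCA -exprD addnC subnK //; exact: ltnW.
  case: (@sx_nonunit (sx ^+ (a - n).-1 * sc c0 * e')).
  by rewrite !mulrA -exprS prednK ?subn_gt0 // -ee E [sc c0 * _]mulrC.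
- by apply: (xreg n); rewrite EP eqN mulrC.
Qed.

Section Fibre.
Variable lam : k.
Hypothesis lam0 : lam != 0.

Fact fibreE : lam%:MP * (lam^-1%:MP * ('X_1 * 'X_0 + 1)) = 'X_1 * 'X_0 + 1 :> C.
Proof. by rewrite mulrA -mpolyCM mulfV // mul1r. Qed.

(** For [lam != 0] the fibre [x = lam] is a plane with coordinates [u] and [t], because
    [y = (t u + 1) / lam] there. *)
Definition fibre : {rmorphism O -> C} := homO (@mpolyC 2 k) fibreE.

Lemma fibre_c c : fibre (sc c) = c%:MP. Proof. exact: homO_c. Qed.
Lemma fibre_t : fibre st = 'X_1. Proof. exact: homO_t. Qed.
Lemma fibre_u : fibre su = 'X_0. Proof. exact: homO_u. Qed.
Lemma fibre_x : fibre sx = lam%:MP. Proof. exact: homO_x. Qed.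

Definition planeO : {rmorphism C -> O} := hom2 sc su st.

Lemma planeO_c c : planeO c%:MP = sc c. Proof. exact: hom2C. Qed.
Lemma planeO_0 : planeO 'X_0 = su. Proof. exact: hom2X0. Qed.
Lemma planeO_1 : planeO 'X_1 = st. Proof. exact: hom2X1. Qed.

Lemma fibre_section f : exists g, f = planeO (fibre f) + (sx - sc lam) * g.
Proof.
pose h : {rmorphism O -> O} := planeO \o fibre.
have hc c : h (sc c) = sc c by rewrite /h /= /fibre /= homO_c planeO_c.
have ht : h st = st by rewrite /h /= /fibre /= homO_t planeO_1.
have hu : h su = su by rewrite /h /= /fibre /= homO_u planeO_0.
have hx : h sx = sc lam by rewrite /h /= /fibre /= homO_x planeO_c.
have hy : h sy = sc lam^-1 * (st * su + 1).
  rewrite /h /= /fibre /= homO_y rmorphM rmorphD rmorphM rmorph1.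
  by rewrite planeO_0 planeO_1 planeO_c.
change (exists g, f = h f + (sx - sc lam) * g); clearbody h.
elim/SL2_ind: f => [c||||| p q [g1 E1] [g2 E2] | p q [g1 E1] [g2 E2]].
- by exists 0; rewrite hc mulr0 addr0.
- by exists 0; rewrite ht mulr0 addr0.
- by exists 0; rewrite hu mulr0 addr0.
- by exists 1; rewrite hx mulr1 addrC subrK.
(* Here [y - x y / lam = (x - lam) (- y / lam)]. *)
- exists (- (sc lam^-1 * sy)); rewrite hy -sxy.
  have cinv : sc lam * sc lam^-1 = 1 by rewrite -rmorphM mulfV // rmorph1.
  rewrite -[LHS]mul1r -[in LHS]cinv; ring.
- by exists (g1 + g2); rewrite {1}E1 {1}E2 rmorphD mulrDr addrACA.
- exists (h p * g2 + g1 * q).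
  transitivity (h p * q + (sx - sc lam) * (g1 * q)); first by rewrite {1}E1; ring.
  by rewrite {1}E2 rmorphM; ring.
Qed.

Lemma fibre_ker f : fibre f = 0 -> exists g, f = (sx - sc lam) * g.
Proof.
move=> f0; have [g E] := fibre_section f; exists g.
rewrite f0 in E.
by rewrite rmorph0 add0r in E.
Qed.

End Fibre.

(* The [G_a]-action [u -> u + x l, y -> y + t l], with [l] the variable of
   [{poly R}]. *)
Definition shear_to (R : comNzRingType) (i : {rmorphism k -> R}) (t u x y : R)
    (E : x * y = t * u + 1) : {rmorphism O -> {poly R}} :=
  homO (polyC \o i) (shear_rel E).

Lemma shear_to_c (R : comNzRingType) (i : {rmorphism k -> R}) (t u x y : R)
  (E : x * y = t * u + 1) c : shear_to i E (sc c) = (i c)%:P.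
Proof. exact: homO_c. Qed.
Lemma shear_to_t (R : comNzRingType) (i : {rmorphism k -> R}) (t u x y : R)
  (E : x * y = t * u + 1) : shear_to i E st = t%:P.
Proof. exact: homO_t. Qed.
Lemma shear_to_u (R : comNzRingType) (i : {rmorphism k -> R}) (t u x y : R)
  (E : x * y = t * u + 1) : shear_to i E su = u%:P + x%:P * 'X.
Proof. exact: homO_u. Qed.
Lemma shear_to_x (R : comNzRingType) (i : {rmorphism k -> R}) (t u x y : R)
  (E : x * y = t * u + 1) : shear_to i E sx = x%:P.
Proof. exact: homO_x. Qed.
Lemma shear_to_y (R : comNzRingType) (i : {rmorphism k -> R}) (t u x y : R)
  (E : x * y = t * u + 1) : shear_to i E sy = y%:P + t%:P * 'X.
Proof. exact: homO_y. Qed.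

Lemma shear_to0 (R : comNzRingType) (i : {rmorphism k -> R}) (t u x y : R)
  (E : x * y = t * u + 1) f : (shear_to i E f)`_0 = homO i E f.
Proof.
rewrite -horner_coef0; apply: (SL2_hom_eq (f := horner_eval 0 \o shear_to i E));
  move=> *; rewrite /= ?(shear_to_c, shear_to_t, shear_to_u, shear_to_x, shear_to_y) /horner_eval;
  by rewrite !hornerE ?mulr0 ?addr0 ?homOE.
Qed.

End Fibration.

(* [phi] stands for a [G_a]-action on [R], which is [k[SL2]] in the application;
   only [x] and [k[u, t][x]] are needed, not the relation between [x] and [y]. *)
Section Extension.
Variables (k : fieldType) (R : comNzRingType).
Local Notation C := (A2 k).
Local Notation D := {poly C}.
Variable j : {rmorphism D -> R}.
Local Notation x := (j 'X).
Hypothesis j_inj : injective j.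
Hypothesis x_reg : forall f, x * f = 0 -> f = 0.
Hypothesis clear_x : forall f, exists n, exists F, x ^+ n * f = j F.

Lemma clear_poly (g : {poly R}) :
  exists N, exists G, (x ^+ N)%:P * g = map_poly j G.
Proof.
elim/poly_ind: g => [|p c [n [G EG]]].
  by exists 0%N, 0; rewrite mulr0 rmorph0.
have [m [P EP]] := clear_x c.
exists (n + m)%N, (('X^m)%:P * G * 'X + ('X^n * P)%:P).
have mC F : map_poly j F%:P = (j F)%:P by exact: map_polyC.
have mX : map_poly j 'X = 'X by exact: map_polyX.
have mM F H : map_poly j (F * H) = map_poly j F * map_poly j H by exact: rmorphM.
have mD F H : map_poly j (F + H) = map_poly j F + map_poly j H by exact: rmorphD.
rewrite mD !mM mX !mC rmorphM !(rmorphXn j) -EG -EP exprD !polyCM.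
by move: (x ^+ n)%:P (x ^+ m)%:P c%:P => a b d; ring.
Qed.

(** The coefficient of [l^i] is multiplied by [x^(M i)], which clears its denominator when [i > 0];
    the constant coefficient has none. A threshold [N] lets two polynomials share one [M]. *)
Lemma clear_poly_rescale (g : {poly R}) c0 : g`_0 = j c0 ->
  exists N, forall M, (N <= M)%N -> exists2 G : {poly D}, G`_0 = c0 &
    map_poly j G = g \Po ((x ^+ M)%:P * 'X).
Proof.
move=> g0; have [N [G EG]] := clear_poly g; exists N => M leM.
have EGi i : x ^+ N * g`_i = j G`_i by rewrite -coefCM EG coef_map.
(* The bound [(size G).+1] keeps index 0 in range even when [G = 0]. *)
exists (\poly_(i < (size G).+1) if i == 0%N then c0 else G`_i * 'X^(M * i - N)).
  by rewrite coef_poly.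
apply/polyP => i; rewrite coef_map coef_poly comp_polyMX ltnS -exprM.
have [->|i0] := eqVneq i 0%N; first by rewrite leq0n muln0 mulr1 g0.
have leN : (N <= M * i)%N by rewrite (leq_trans leM) // leq_pmulr // lt0n.
have -> : g`_i * x ^+ (M * i) = j (G`_i * 'X^(M * i - N)).
  by rewrite (rmorphM j) -EGi (rmorphXn j) [RHS]mulrAC -exprD subnKC // mulrC.
by case: ltnP => // /ltnW/leq_sizeP ->; rewrite // mul0r.
Qed.

Variable phi : {rmorphism R -> {poly R}}.
Hypothesis phiC : forall c, phi (j c%:MP%:P) = (j c%:MP%:P)%:P.
Hypothesis phiX : phi x = x%:P.
Hypothesis phi0 : forall f, (phi f)`_0 = f.
Hypothesis j_curve : forall f P, x * f = j P ->
  exists q, P.[0] = (1 + 'X_1 * 'X_0) * q.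

(** Cancel the common power of [x] in [f = P / x^n]. If a denominator remains, the reduced numerator
    [Q] is fixed and [Q.[0]] is a nonzero multiple of [1 + t u], against [degenerate_factor]. *)
Lemma fixed_in_subring (f : R) : phi f = f%:P ->
  (exists g, phi g != g%:P) -> exists P, f = j P.
Proof.
move=> phif [g phig]; have xn_reg := mulr_reg_exp x_reg.
have [->|f0] := eqVneq f 0; first by exists 0; rewrite rmorph0.
have [n [P EP]] := clear_x f.
have P0 : P != 0.
  by apply: contraNneq f0 => P0; apply/eqP/(@xn_reg n); rewrite EP P0 rmorph0.
have [Q EQ /(_ P0) Q0] := ordXP P; set a := ordX P in EQ.
have xreg i : injective ( *%R (x ^+ i)).
  move=> u v /eqP; rewrite -subr_eq0 -mulrBr => /eqP/xn_reg/eqP.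
  by rewrite subr_eq0 => /eqP.
have [le|lt] := leqP n a.
  exists (Q * 'X^(a - n)); apply: (xreg n); rewrite EP EQ.
  by rewrite rmorphM rmorphXn rmorphM rmorphXn mulrCA -exprD subnKC.
have Ef : x ^+ (n - a) * f = j Q.
  apply: (xreg a); rewrite mulrA -exprD subnKC; last exact: ltnW.
  by rewrite EP EQ rmorphM rmorphXn mulrC.
have [q Eq] : exists q, Q.[0] = (1 + 'X_1 * 'X_0) * q.
  apply: (j_curve (f := x ^+ (n - a).-1 * f)).
  by rewrite mulrA -exprS prednK ?subn_gt0.
have [Nt Ht] := @clear_poly_rescale (phi (j ('X_1)%:P)) ('X_1)%:P (phi0 _).
have [Nu Hu] := @clear_poly_rescale (phi (j ('X_0)%:P)) ('X_0)%:P (phi0 _).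
have [tt tt0 Ett] := Ht _ (leq_maxl Nt Nu).
have [uu uu0 Euu] := Hu _ (leq_maxr Nt Nu).
set M := maxn Nt Nu in Ett Euu.
pose La : {rmorphism {poly R} -> {poly R}} := comp_poly ((x ^+ M)%:P * 'X).
have LaC c : La c%:P = c%:P by exact: comp_polyC.
pose mj : {rmorphism {poly D} -> {poly R}} := map_poly j.
have mjC c : mj c%:P = (j c)%:P by exact: map_polyC.
have mj_inj : injective mj by exact: map_inj_poly j_inj (rmorph0 j).
pose i0 : {rmorphism k -> R} := j \o polyC \o @mpolyC 2 k.
pose i1 : {rmorphism k -> {poly R}} := polyC \o i0.
pose i3 : {rmorphism k -> {poly D}} := polyC \o polyC \o @mpolyC 2 k.
have phij F : phi (j F) = homD i1 (phi (j ('X_0)%:P)) (phi (j ('X_1)%:P)) x%:P F.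
  apply: (homD_unique (f := phi \o j)) => //; exact: phiC.
case: (negP Q0); apply/eqP; apply: (@degenerate_factor k Q tt uu tt0 uu0 _ _ q Eq).
  (* If neither image involved [l], then [phi] would fix [u], [t] and [x], hence all of [j]; as [x]
     is regular, it would fix every element, contrary to [phig]. *)
  apply/negP => /andP[/size1_polyC Et /size1_polyC Eu].
  have const (F : D) (h : {poly D}) : h = (h`_0)%:P -> h`_0 = F ->
      map_poly j h = La (phi (j F)) -> phi (j F) = (j F)%:P.
    move=> Eh h0 EL; apply/polyP => i.
    have := congr1 (fun p : {poly R} => p`_i) EL; rewrite /La comp_polyMX.
    rewrite Eh h0 map_polyC /= coefC => Ei.
    case: i Ei => [|i] /= Ei; first by rewrite phi0.
    by apply: (@xn_reg (M * i.+1)); rewrite mulrC exprM -Ei.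
  have {}Et := const _ tt Et tt0 Ett; have {}Eu := const _ uu Eu uu0 Euu.
  have [m [G EG]] := clear_x g.
  have E : phi (x ^+ m * g) = (x ^+ m * g)%:P.
    rewrite EG phij; transitivity (homD i1 (j ('X_0)%:P)%:P (j ('X_1)%:P)%:P x%:P G).
      exact: homD_congr Eu Et erefl G.
    have H := @homD_unique k _ i1 (j ('X_0)%:P)%:P (j ('X_1)%:P)%:P x%:P
      (polyC \o j) (fun c => erefl) erefl erefl erefl G.
    exact: esym H.
  case: (negP phig); apply/eqP/polyP => i.
  apply: (xreg m); rewrite -!coefCM -polyCM -E rmorphM rmorphXn phiX.
  by rewrite polyC_exp.
(* The rescaled identity is checked in [{poly R}]: [phi] fixes [x] and [f], hence [j Q], and [La]
   leaves constants unchanged. *)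
apply: mj_inj; rewrite mjC -Ef.
transitivity (homD i1 (mj uu) (mj tt) (mj 'X%:P) Q).
  by apply: homD_comp => c; rewrite !mjC.
transitivity (La (phi (j Q))).
  have Ex : mj 'X%:P = La x%:P by rewrite mjC LaC.
  transitivity (homD i1 (La (phi (j ('X_0)%:P))) (La (phi (j ('X_1)%:P))) (La x%:P) Q).
    exact: homD_congr Euu Ett Ex Q.
  rewrite [in RHS]phij; apply: esym.
  by apply: homD_comp => c; exact: LaC.
by rewrite -Ef rmorphM phif rmorphXn phiX -polyC_exp -polyCM LaC.
Qed.

End Extension.

(** * Jacobians *)

Section Jacobian.
Variable k : fieldType.
Local Notation C := (A2 k).
Local Notation D := {poly C}.

Lemma mderiv_X (i j : 'I_2) : mderiv i 'X_j = (i == j)%:R :> C.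
Proof.
rewrite mderivX mnm1E eq_sym; case: eqVneq => [->|_]; last by rewrite scale0r.
by rewrite scale1r -mpolyX0; congr 'X_[_]; apply/mnmP => l; rewrite mnmBE subnn mnm0E.
Qed.

(** Both sides are derivations along [hom2 i u t], so the generators suffice. A general [d] serves
    the partial derivatives both of [A2 k] and of [{poly A2 k}]. *)
Lemma hom2_chain (A : comNzRingType) (i : {rmorphism k -> A}) (u t : A) (d : A -> A) :
  (forall a b, d (a + b) = d a + d b) ->
  (forall a b, d (a * b) = d a * b + a * d b) -> (forall c, d (i c) = 0) ->
  forall p, d (hom2 i u t p) =
    hom2 i u t (mderiv 0 p) * d u + hom2 i u t (mderiv 1 p) * d t.
Proof.
move=> dD dM di; elim/A2_ind => [c|||p q Hp Hq|p q Hp Hq].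
- by rewrite !mderivC !rmorph0 !mul0r addr0 hom2C.
- by rewrite !mderiv_X /= rmorph1 rmorph0 mul1r mul0r addr0 hom2X0.
- by rewrite !mderiv_X /= rmorph1 rmorph0 mul1r mul0r add0r hom2X1.
- by rewrite rmorphD dD Hp Hq !mderivD !rmorphD; ring.
- by rewrite rmorphM dM Hp Hq !mderivM !rmorphD !rmorphM; ring.
Qed.

(** The partial derivative over [k[x]]: the outer variable [x] counts as a constant. *)
Definition deriv_coef (i : 'I_2) : D -> D := map_poly (mderiv i).

Lemma deriv_coefD i p q : deriv_coef i (p + q) = deriv_coef i p + deriv_coef i q.
Proof. exact: raddfD. Qed.

Lemma deriv_coefM i p q :
  deriv_coef i (p * q) = deriv_coef i p * q + p * deriv_coef i q.
Proof.
apply/polyP => n; rewrite coefD !coef_map !coefM raddf_sum -big_split /=.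
by apply: eq_bigr => l _; rewrite mderivM !coef_map.
Qed.

Lemma deriv_coefC i c : deriv_coef i c%:P = (mderiv i c)%:P.
Proof. exact: map_polyC. Qed.

Lemma deriv_coefX i : deriv_coef i 'X = 0.
Proof.
apply/polyP => n; rewrite coef_map coefX coef0 /=.
by case: (n == 1%N); rewrite ?mderiv0 // -mpolyC1 mderivC.
Qed.

Lemma homD_chain (A : comNzRingType) (i : {rmorphism k -> A}) (u t x : A) (d : A -> A) :
  (forall a b, d (a + b) = d a + d b) ->
  (forall a b, d (a * b) = d a * b + a * d b) -> (forall c, d (i c) = 0) -> d x = 0 ->
  forall p, d (homD i u t x p) =
    homD i u t x (deriv_coef 0 p) * d u + homD i u t x (deriv_coef 1 p) * d t.
Proof.
move=> dD dM di dx; elim/polyX_ind => [c||p q Hp Hq|p q Hp Hq].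
- by rewrite !deriv_coefC !homD_C (hom2_chain _ _ dD dM di).
- by rewrite !deriv_coefX !rmorph0 !mul0r addr0 homD_X.
- by rewrite rmorphD dD Hp Hq !deriv_coefD !rmorphD; ring.
- by rewrite rmorphM dM Hp Hq !deriv_coefM !rmorphD !rmorphM; ring.
Qed.

Lemma mderiv_horner i (p : D) c : mderiv i c = 0 ->
  mderiv i p.[c] = (deriv_coef i p).[c].
Proof.
move=> dc; elim/poly_ind: p => [|p a IH].
  by rewrite /deriv_coef map_poly0 horner0 mderiv0.
rewrite deriv_coefD deriv_coefM deriv_coefX deriv_coefC mulr0 addr0.
have H (q : D) (b : C) : (q * 'X + b%:P).[c] = q.[c] * c + b by exact: hornerMXaddC.
transitivity (mderiv i (p.[c] * c + a)); first by congr (mderiv i _); exact: H.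
transitivity ((deriv_coef i p).[c] * c + mderiv i a); last exact: esym (H _ _).
by rewrite mderivD mderivM dc IH mulr0 addr0.
Qed.

(** The hypotheses say that two 2 x 2 matrices have product 1, and the determinant is
    multiplicative. *)
Lemma det_inv (R : comNzRingType) (a b c d u0 u1 t0 t1 : R) :
  1 = a * u0 + b * t0 -> 0 = a * u1 + b * t1 ->
  0 = c * u0 + d * t0 -> 1 = c * u1 + d * t1 ->
  (a * d - b * c) * (u0 * t1 - u1 * t0) = 1.
Proof.
move=> E1 E2 E3 E4; transitivity
  ((a * u0 + b * t0) * (c * u1 + d * t1) - (a * u1 + b * t1) * (c * u0 + d * t0)).
  by ring.
by rewrite -E1 -E2 -E3 -E4; ring.
Qed.

Lemma mpoly_unitP n (p q : {mpoly k[n]}) : p * q = 1 -> exists2 c, c != 0 & p = c%:MP.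
Proof.
move=> pq; have := mpoly_intro_unit (etrans (mulrC q p) pq).
by case/andP=> /eqP Ep; rewrite unitfE => c0; exists p@_0.
Qed.

Lemma jacobian_unit (f g f' g' : C) :
  hom2 (@mpolyC 2 k) f g f' = 'X_0 -> hom2 (@mpolyC 2 k) f g g' = 'X_1 ->
  exists2 c, c != 0 & jacobian f g = c%:MP.
Proof.
move=> Ef Eg; have chain p i := hom2_chain f g (@mderivD _ _ i) (@mderivM _ _ i)
  (fun c => mderivC i c) p.
have := chain f' 0; have := chain f' 1; have := chain g' 0; have := chain g' 1.
rewrite Ef Eg !mderiv_X /= => E4 E3 E2 E1.
by apply: (@mpoly_unitP 2 _ _); rewrite mulrC; apply: det_inv E1 E2 E3 E4.
Qed.

Definition jacobianD (u t : D) : D :=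
  deriv_coef 0 u * deriv_coef 1 t - deriv_coef 1 u * deriv_coef 0 t.

Lemma jacobianD_horner u t c : (forall i, mderiv i c = 0) ->
  jacobian u.[c] t.[c] = (jacobianD u t).[c].
Proof. by move=> dc; rewrite /jacobian !mderiv_horner // hornerD hornerN !hornerM. Qed.

Definition polyD : {rmorphism k -> D} := polyC \o @mpolyC 2 k.

Lemma jacobianD_unit (u t u' t' : D) :
  homD polyD u t 'X u' = ('X_0)%:P -> homD polyD u t 'X t' = ('X_1)%:P ->
  exists2 c, c != 0 & jacobianD u t = c%:MP%:P.
Proof.
move=> Eu Et.
have dc i c : deriv_coef i (polyD c) = 0 by rewrite deriv_coefC mderivC.
have chain p i := homD_chain u t (@deriv_coefD i) (@deriv_coefM i) (dc i)
  (deriv_coefX i) p.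
have dX i j : deriv_coef i ('X_j)%:P = (i == j)%:R.
  by rewrite deriv_coefC mderiv_X; case: (i == j).
have [v Ev] : exists v, v * jacobianD u t = 1.
  have := chain u' 0; have := chain u' 1; have := chain t' 0; have := chain t' 1.
  rewrite Eu Et !dX /= => E4 E3 E2 E1.
  by eexists; apply: det_inv E1 E2 E3 E4.
have : jacobianD u t \is a GRing.unit.
  apply/unitrP; exists v; split; first exact: Ev.
  by rewrite -Ev; exact: mulrC.
rewrite poly_unitE => /andP[/size_poly1P[c c0 ->]]; rewrite coefC eqxx => /unitrP[w [_ cw]].
have [c1 c10 ->] := mpoly_unitP cw; by exists c1.
Qed.

(** Comparison of coefficients for the equation of [jacobian_curve] restricted to a line through the
    origin. *)
Lemma affine_mul_poly (a b a' b' e d : k) :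
  (a%:P + b%:P * 'X) * (a'%:P + b'%:P * 'X) + 1 = e%:P * (1 + d%:P * 'X * 'X) ->
  [/\ a * a' + 1 = e, a * b' + b * a' = 0 & b * b' = e * d].
Proof.
move=> E.
have {}E : (a * a' + 1 - e)%:P + (a * b' + b * a')%:P * 'X + (b * b' - e * d)%:P * 'X^2 = 0.
  have := E; move/eqP; rewrite -subr_eq0 => /eqP <-.
  by rewrite !(polyCD, polyCN, polyCM); ring.
have cf n : ((a * a' + 1 - e)%:P + (a * b' + b * a')%:P * 'X +
   (b * b' - e * d)%:P * 'X^2)`_n = 0 by rewrite E coef0.
have := cf 0%N; have := cf 1%N; have := cf 2%N.
rewrite !coefD !coefCM !coefX !coefXn !coefC /=.
rewrite !(mulr0, mulr1, addr0, add0r) => /eqP; rewrite subr_eq0 => /eqP Eb Ec /eqP.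
by rewrite subr_eq0 => /eqP Ea.
Qed.

Lemma msize2_affine (p : C) : (msize p <= 2)%N ->
  exists a b c, p = a%:MP + b%:MP * 'X_0 + c%:MP * 'X_1.
Proof.
move=> sp; rewrite [p]mpolyE big_seq.
elim/big_ind: _ => [|q r [a [b [c ->]]] [a' [b' [c' ->]]]|m mp].
- by exists 0, 0, 0; rewrite mpolyC0 !mul0r !addr0.
- by exists (a + a'), (b + b'), (c + c'); rewrite !mpolyCD; ring.
have : (mdeg m <= 1)%N by rewrite -ltnS (leq_trans (msize_mdeg_lt mp)).
rewrite leq_eqVlt ltnS leqn0 => /orP[|].
  move=> /mdeg1P [i /eqP ->]; rewrite -mul_mpolyC.
  have [->|->] : i = 0 \/ i = 1.
    by case: i => -[|[|//]] lti; [left|right]; apply: val_inj.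
  - by exists 0, p@_U_(0), 0; rewrite mpolyC0 !mul0r addr0 add0r.
  - by exists 0, 0, p@_U_(1); rewrite mpolyC0 !mul0r !add0r.
rewrite mdeg_eq0 => /eqP ->; exists p@_0, 0, 0.
by rewrite -mul_mpolyC mpolyX0 mpolyC0 !mul0r !addr0 mulr1.
Qed.

(** A nonzero Jacobian makes [t] and [u] nonconstant, so the degree of [t u] forces both to be
    affine. Their linear parts are then multiples of different coordinates with coefficients of
    product [e], and the vanishing of a constant term gives [e = 1]; which coordinate goes where
    decides the sign. *)
Lemma jacobian_curve (u t : C) (e c : k) : e != 0 -> c != 0 ->
  t * u + 1 = e%:MP * (1 + 'X_1 * 'X_0) -> jacobian u t = c%:MP -> c = 1 \/ c = -1.
Proof.
move=> e0 c0 E J.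
have big (p : C) : (forall a, p <> a%:MP) -> (2 <= msize p)%N.
  by move=> H; rewrite ltnNge; apply/negP => /msize1_polyC; apply: H.
have su : (2 <= msize u)%N.
  apply: big => a Eu; move: J; rewrite /jacobian Eu !mderivC !mul0r subr0 -mpolyC0.
  by move/eqP; rewrite mpolyC_eq eq_sym (negPf c0).
have s_t : (2 <= msize t)%N.
  apply: big => a Et; move: J; rewrite /jacobian Et !mderivC !mulr0 subr0 -mpolyC0.
  by move/eqP; rewrite mpolyC_eq eq_sym (negPf c0).
have stu : (msize (t * u) <= 3)%N.
  rewrite -[t * u](addrK 1) E mulrDr mulr1 addrAC.
  apply: leq_trans (msizeD_le _ _) _; rewrite geq_max; apply/andP; split.
    by rewrite -mpolyC1 -mpolyCB msizeC; case: eqP.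
  rewrite mul_mpolyC; apply: leq_trans (msizeZ_le _ _) _.
  by rewrite -mpolyXD msizeX mdegD !mdeg1.
have nz (p : C) : (2 <= msize p)%N -> p != 0.
  by apply: contraTneq => ->; rewrite msize0.
rewrite msizeM ?nz // in stu.
have [st2 su2] : (msize t <= 2)%N /\ (msize u <= 2)%N.
  by move: su s_t stu; move: (msize t) (msize u) => a b; lia.
have [p0 [p1 [p2 Et]]] := msize2_affine st2.
have [q0 [q1 [q2 Eu]]] := msize2_affine su2.
(* Restriction to the line of direction [(a, b)]. The directions [(1, 0)], [(0, 1)] and [(1, 1)]
   isolate both squares and the cross term in every characteristic. *)
have res a b d : a * b = d ->
    (p0%:P + (p1 * a + p2 * b)%:P * 'X) * (q0%:P + (q1 * a + q2 * b)%:P * 'X) + 1 =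
    e%:P * (1 + d%:P * 'X * 'X) :> {poly k}.
  move=> ab; have := congr1 (hom2 (@polyC k) (a%:P * 'X) (b%:P * 'X)) E.
  rewrite Et Eu !(rmorphD, rmorphM, rmorph1) /= !hom2C !hom2X0 !hom2X1 => H.
  rewrite -ab; transitivity ((p0%:P + p1%:P * (a%:P * 'X) + p2%:P * (b%:P * 'X)) *
    (q0%:P + q1%:P * (a%:P * 'X) + q2%:P * (b%:P * 'X)) + 1).
    by ring.
  by rewrite H !polyCM; ring.
have [E1 E2 E3] := affine_mul_poly (res 1 0 0 (mulr0 1)).
have [_ E4 E5] := affine_mul_poly (res 0 1 0 (mul0r 1)).
have [_ _ E6] := affine_mul_poly (res 1 1 1 (mul1r 1)).
rewrite !(mulr0, mulr1, addr0, add0r) in E1 E2 E3 E4 E5 E6.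
have Ec : c = q1 * p2 - q2 * p1.
  apply/eqP; rewrite -(@mpolyC_eq 2) -J /jacobian Et Eu.
  rewrite !mderivD !mderiv_mulC !mderivC !mderiv_X /= !(mulr0, mulr1, addr0, add0r).
  by rewrite mpolyCB !mpolyCM eqxx.
have E6' : p1 * q2 + p2 * q1 = e.
  by rewrite -E6; transitivity (p1 * q1 + p1 * q2 + p2 * q1 + p2 * q2);
     [rewrite E3 E5 add0r addr0|ring].
move/eqP: E3; rewrite mulf_eq0 => /orP[] /eqP z1.
- move: E6' E2; rewrite z1 !mul0r add0r addr0 => E6' E2.
  have /andP[p20 q10] : (p2 != 0) && (q1 != 0) by rewrite -negb_or -mulf_eq0 E6'.
  have p00 : p0 = 0 by move/eqP: E2; rewrite mulf_eq0 (negPf q10) orbF => /eqP.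
  left; rewrite Ec z1 mulr0 subr0 mulrC E6'.
  by rewrite -E1 p00 mul0r add0r.
- move: E6' E2; rewrite z1 !mulr0 add0r addr0 => E6' E2.
  have /andP[p10 q20] : (p1 != 0) && (q2 != 0) by rewrite -negb_or -mulf_eq0 E6'.
  have q00 : q0 = 0 by move/eqP: E2; rewrite mulf_eq0 (negPf p10) => /eqP.
  right; rewrite Ec z1 mul0r sub0r mulrC E6'.
  by rewrite -E1 q00 mulr0 add0r.
Qed.

End Jacobian.

(** * Automorphisms of SL2 extending an automorphism of the plane *)

Section OnlyIf.
Variable k : fieldType.
Local Notation O := (SL2 k).
Local Notation C := (A2 k).
Local Notation D := {poly C}.
Local Notation sc := (@sc k).
Local Notation st := (@st k).
Local Notation su := (@su k).
Local Notation sx := (@sx k).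
Local Notation sy := (@sy k).
Local Notation jD := (@jD k).

(** The relation determines the image of [y] as soon as the image of [x] is regular. *)
Lemma SL2_hom_eq_reg (A : comNzRingType) (f g : {rmorphism O -> A}) :
  (forall c, f (sc c) = g (sc c)) -> f st = g st -> f su = g su ->
  f sx = g sx -> (forall a, f sx * a = 0 -> a = 0) -> f =1 g.
Proof.
move=> fC ft fu fx reg; apply: SL2_hom_eq => //.
apply/eqP; rewrite -subr_eq0; apply/eqP/reg.
have E (h : {rmorphism O -> A}) : h sx * h sy = h st * h su + 1.
  by rewrite -rmorphM sxy rmorphD rmorphM rmorph1.
by rewrite mulrBr E fx E ft fu subrr.
Qed.

(** The factor [e] is a unit, hence a scalar [c], and [al] maps [x] to [c (x - lam)] with
    [lam = 1 - c^-1]. It remains to exclude [lam != 0]. *)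
Lemma shift_fixed (al ga : {rmorphism O -> O}) (e e' : O) :
  (forall c, al (sc c) = sc c) -> (forall c, ga (sc c) = sc c) ->
  cancel al ga -> cancel ga al ->
  al (sx - 1) = (sx - 1) * e -> ga (sx - 1) = (sx - 1) * e' -> al sx = sx.
Proof.
move=> alc gac alK gaK Ee Ee'.
have x1 : sx - 1 != 0.
  apply/eqP => /(congr1 (@zero_fibre k)); rewrite rmorphB zero_fibre_x rmorph1 rmorph0.
  by move/eqP; rewrite sub0r oppr_eq0 oner_eq0.
have /sl2_unit[c c0 Ec] : e * al e' = 1.
  apply: (sl2_mulfI x1); rewrite mulrA -Ee -rmorphM -Ee' gaK mulr1.
  by [].
have cinv : sc c * sc c^-1 = 1 by rewrite -rmorphM mulfV // rmorph1.
have Eal : al sx = sc c * (sx - sc (1 - c^-1)).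
  rewrite rmorphB rmorph1 in Ee; rewrite -[LHS](subrK 1) Ee Ec rmorphB rmorph1.
  transitivity (sc c * (sx - 1) + sc c * sc c^-1); last by ring.
  by rewrite cinv; ring.
have [lam0|lam0] := eqVneq (1 - c^-1) 0.
  rewrite Eal lam0 rmorph0 subr0.
  have -> : c = 1 by apply: invr_inj; apply/eqP; rewrite invr1 eq_sym -subr_eq0 lam0.
  by rewrite rmorph1 mul1r.
exfalso; move: (1 - c^-1) Eal lam0 => lam Eal lam0.
have hker := @fibre_ker k lam lam0.
have := fibre_c lam0; have := fibre_x lam0; move: (fibre lam0) hker => h hker hx0 hc.
have hx : h (al sx) = 0 by rewrite Eal rmorphM rmorphB hx0 !hc subrr mulr0.
(* On the plane [x = lam] the image of [x y = t u + 1] vanishes, so [al t] is a unit there, that is,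
   a constant [a]. *)
have /mpoly_unitP[a a0 Ea] : h (al st) * (- h (al su)) = 1.
  have : h (al (sx * sy)) = 0 by rewrite rmorphM rmorphM hx mul0r.
  rewrite sxy !rmorphD !rmorphM !rmorph1 => H.
  by rewrite mulrN; apply/eqP; rewrite -subr_eq0 -opprD oppr_eq0 H.
have [g Eg] : exists g, al st - sc a = (sx - sc lam) * g.
  by apply: hker; rewrite rmorphB Ea hc subrr.
(* Applying [ga] to the divisibility of [al t - a] by [x - lam] makes [t - a] divisible by [x],
   although [t] is not constant on the fibre [x = 0]. *)
have : zero_fibre k (st - sc a) = 0.
  have <- : ga (al st - sc a) = st - sc a by rewrite rmorphB alK gac.
  rewrite Eg rmorphM; rewrite (_ : sx - sc lam = sc c^-1 * al sx).
    by rewrite rmorphM alK [_ * sx]mulrC -mulrA rmorphM zero_fibre_x mul0r.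
  by rewrite Eal mulrA [sc _ * _]mulrC cinv mul1r.
rewrite rmorphB zero_fibre_t zero_fibre_c /ratT /ratC /= -rmorphB => /eqP.
by rewrite tofrac_eq0 polyXsubC_eq0.
Qed.

Lemma image_in_subring (al ga : {rmorphism O -> O}) :
  (forall c, al (sc c) = sc c) -> (forall c, ga (sc c) = sc c) ->
  cancel al ga -> cancel ga al -> al sx = sx -> exists P, al st = jD P.
Proof.
move=> alc gac alK gaK alx.
have gax : ga sx = sx by rewrite -{1}alx alK.
pose sh := shear_to sc (sxy k).
pose mal : {rmorphism {poly O} -> {poly O}} := map_poly al.
have malC c : mal c%:P = (al c)%:P by exact: map_polyC.
pose phi : {rmorphism O -> {poly O}} := mal \o (sh \o ga).
have phiE f : phi f = mal (sh (ga f)) by [].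
have sh0 f : (sh f)`_0 = f.
  rewrite /sh shear_to0; apply: (SL2_hom_eq (f := homO sc (sxy k)) (g := idfun)).
  - by move=> c; exact: homO_c.
  - exact: homO_t.
  - exact: homO_u.
  - exact: homO_x.
  - exact: homO_y.
apply: (@fixed_in_subring k O jD _ _ _ phi).
- exact: jD_inj.
- by move=> f; rewrite jDX; apply: sx_reg.
- by move=> f; rewrite jDX; apply: clear_sx.
- by move=> c; rewrite jDC phiE gac /sh shear_to_c malC alc.
- by rewrite jDX phiE gax /sh shear_to_x malC alx.
- by move=> f; rewrite phiE /mal coef_map /= sh0 gaK.
- by move=> f P; rewrite jDX; apply: zero_fibre_dvd.
- by rewrite phiE alK /sh shear_to_t malC.
(* The conjugated action is nontrivial: the coefficient of [l] in the image of [al u] is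
   [al x = x]. *)
have phi1 : (phi (al su))`_1 = sx.
  rewrite phiE alK /sh shear_to_u.
  transitivity (al (su%:P + sx%:P * 'X)`_1); first exact: coef_map.
  by rewrite shear_coef1.
exists (al su); apply/eqP => E; move: phi1; rewrite E coefC /= => /esym/eqP.
exact/negP/sx_neq0.
Qed.

End OnlyIf.

(** * The restriction to [k[u, t][x]] and its Jacobian *)

Section Volume.
Variable k : fieldType.
Local Notation O := (SL2 k).
Local Notation C := (A2 k).
Local Notation D := {poly C}.
Local Notation sc := (@sc k).
Local Notation st := (@st k).
Local Notation su := (@su k).
Local Notation sx := (@sx k).
Local Notation sy := (@sy k).
Local Notation jD := (@jD k).

Fact swapE : sx * sy = su * st + 1.
Proof. by rewrite sxy mulrC. Qed.

Definition swapO : {rmorphism O -> O} := homO sc swapE.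

Lemma swapO_c c : swapO (sc c) = sc c. Proof. exact: homO_c. Qed.
Lemma swapO_t : swapO st = su. Proof. exact: homO_t. Qed.
Lemma swapO_u : swapO su = st. Proof. exact: homO_u. Qed.
Lemma swapO_x : swapO sx = sx. Proof. exact: homO_x. Qed.

Lemma SL2_hom_id (f : {rmorphism O -> O}) :
  (forall c, f (sc c) = sc c) -> f st = st -> f su = su -> f sx = sx -> f =1 id.
Proof.
move=> fc ft fu fx;
by apply: (SL2_hom_eq_reg (g := idfun) fc ft fu fx) => a; rewrite fx; apply: sx_reg.
Qed.

Lemma swapOK : involutive swapO.
Proof.
apply: (SL2_hom_id (f := swapO \o swapO)) => [c|||] /=.
- by rewrite !swapO_c.
- by rewrite swapO_t swapO_u.
- by rewrite swapO_u swapO_t.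
- by rewrite !swapO_x.
Qed.

Section Automorphism.
Variables al ga : {rmorphism O -> O}.
Hypotheses (alc : forall c, al (sc c) = sc c) (gac : forall c, ga (sc c) = sc c).
Hypotheses (alK : cancel al ga) (gaK : cancel ga al) (alx : al sx = sx).

(** Composing with the transposition reduces the case of [u] to that of [t]. *)
Lemma images_in_subring : exists U T, al su = jD U /\ al st = jD T.
Proof.
have [T ET] := image_in_subring alc gac alK gaK alx.
have [||||| U EU] := @image_in_subring k (al \o swapO) (swapO \o ga).
- by move=> c /=; rewrite swapO_c alc.
- by move=> c /=; rewrite gac swapO_c.
- by move=> f /=; rewrite alK swapOK.
- by move=> f /=; rewrite swapOK gaK.
- by rewrite /= swapO_x alx.
by exists U, T; rewrite -ET -EU /= swapO_t.
Qed.

Lemma restrict_subring U T P : al su = jD U -> al st = jD T ->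
  al (jD P) = jD (homD (@polyD k) U T 'X P).
Proof.
move=> EU ET; transitivity (al (homD sc su st sx P)); first by [].
rewrite (homD_comp (i' := sc)); last by move=> c; rewrite alc.
rewrite EU ET alx; symmetry.
rewrite (homD_comp (i' := sc)); last by move=> c; exact: jDC.
exact: homD_congr erefl erefl (jDX k) P.
Qed.

(** The image of [t u + 1 = x y] is divisible by [al x = x], so it vanishes on the fibre [x = 0]. *)
Lemma curve_image U T : al su = jD U -> al st = jD T ->
  exists q, T.[0] * U.[0] + 1 = (1 + 'X_1 * 'X_0) * q.
Proof.
move=> EU ET; apply: curve_ideal; apply: etrans (_ : curve k (T * U + 1).[0] = _).
  by rewrite hornerD hornerM hornerC.
rewrite -zero_fibre_j rmorphD rmorphM rmorph1 -EU -ET -rmorphM -(rmorph1 al) -rmorphD.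
by rewrite -sxy rmorphM alx rmorphM zero_fibre_x mul0r.
Qed.

End Automorphism.

Lemma homD_horner0 U T (P : D) :
  (homD (@polyD k) U T 'X P).[0] = hom2 (@mpolyC 2 k) U.[0] T.[0] P.[0].
Proof.
transitivity (homD (@mpolyC 2 k) U.[0] T.[0] ('X : D).[0] P).
  by apply: (homD_comp _ _ _ _ (f := horner_eval 0)) => c; exact: hornerC.
by rewrite hornerX homD_0.
Qed.

Lemma volume_preserving (al ga : {rmorphism O -> O}) :
  (forall c, al (sc c) = sc c) -> (forall c, ga (sc c) = sc c) ->
  cancel al ga -> cancel ga al -> al sx = sx ->
  exists U T, [/\ al su = jD U, al st = jD T &
    jacobian U.[1] T.[1] = 1 \/ jacobian U.[1] T.[1] = -1].
Proof.
move=> alc gac alK gaK alx.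
have gax : ga sx = sx by rewrite -{1}alx alK.
have [U [T [EU ET]]] := images_in_subring alc gac alK gaK alx.
have [U' [T' [EU' ET']]] := images_in_subring gac alc gaK alK gax.
exists U, T; split; [exact: EU|exact: ET|].
have HU : homD (@polyD k) U T 'X U' = ('X_0)%:P.
  by apply: jD_inj; rewrite -(restrict_subring alc alx _ EU ET) -EU' gaK jD0.
have HT : homD (@polyD k) U T 'X T' = ('X_1)%:P.
  by apply: jD_inj; rewrite -(restrict_subring alc alx _ EU ET) -ET' gaK jD1.
have [c c0 Ec] := jacobianD_unit HU HT.
have [q Eq] := curve_image alx EU ET.
have [q' Eq'] := curve_image gax EU' ET'.
pose h : {rmorphism C -> C} := hom2 (@mpolyC 2 k) U.[0] T.[0].
have h0 : h 'X_0 = U.[0] by exact: hom2X0.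
have h1 : h 'X_1 = T.[0] by exact: hom2X1.
have hU : h U'.[0] = 'X_0
  by apply: etrans (esym (homD_horner0 _ _ _)) _; rewrite HU hornerC.
have hT : h T'.[0] = 'X_1
  by apply: etrans (esym (homD_horner0 _ _ _)) _; rewrite HT hornerC.
(* At [x = 0] the equation of the curve goes to [q] times itself, and likewise for [ga] with [q'];
   composing shows that [h q'] is inverse to [q]. *)
have [e e0 Ee] : exists2 e, e != 0 & q = e%:MP.
  apply: (@mpoly_unitP k 2 q (h q')).
  clearbody h; move/(congr1 h): Eq'; rewrite rmorphD !rmorphM rmorphD rmorphM rmorph1.
  rewrite hU hT h0 h1 [1 + _ * _]addrC Eq -mulrA => E.
  have nz : 1 + 'X_1 * 'X_0 != 0 :> C.
    apply/eqP => /(congr1 (meval (fun=> 0))); rewrite rmorphD rmorphM /= !mevalXU.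
    by rewrite rmorph1 rmorph0 mulr0 addr0 => /eqP; rewrite oner_eq0.
  by apply: (mulfI nz); rewrite mulr1 -E addrC.
(* The Jacobian over [k[x]] does not involve [x], so [x = 0] and [x = 1] share the value [c]. *)
have J x : (forall i, mderiv i x = 0) -> jacobian U.[x] T.[x] = c%:MP.
  by move=> dx; rewrite jacobianD_horner // Ec hornerC.
have [||Hc|Hc] := @jacobian_curve k U.[0] T.[0] e c e0 c0.
- by rewrite Eq Ee mulrC.
- by apply: J => i; exact: mderiv0.
- by left; rewrite J ?Hc ?mpolyC1 // => i; rewrite -mpolyC1 mderivC.
- by right; rewrite J ?Hc ?mpolyCN ?mpolyC1 // => i; rewrite -mpolyC1 mderivC.
Qed.

Lemma SL2_lr_sc (f : {lrmorphism O -> C}) c : f (sc c) = c%:MP.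
Proof. by rewrite -sl2_alg linearZ rmorph1 /= -mul_mpolyC mulr1. Qed.

Lemma SL2_end_sc (f : {lrmorphism O -> O}) c : f (sc c) = sc c.
Proof. by rewrite -[in LHS]sl2_alg linearZ rmorph1; exact: sl2_alg. Qed.

Lemma rho_t (lam : k) : rho lam st = 'X_1.
Proof.
rewrite rho_pi; have [-> _ _ _] // := comp_coords ('X_1 : C) (lam *: 'X_0) 1
  (1 + lam *: ('X_0 * 'X_1)).
Qed.
Lemma rho_u (lam : k) : rho lam su = lam *: 'X_0.
Proof.
rewrite rho_pi; have [_ -> _ _] // := comp_coords ('X_1 : C) (lam *: 'X_0) 1
  (1 + lam *: ('X_0 * 'X_1)).
Qed.
Lemma rho_x (lam : k) : rho lam sx = 1.
Proof.
rewrite rho_pi; have [_ _ -> _] // := comp_coords ('X_1 : C) (lam *: 'X_0) 1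
  (1 + lam *: ('X_0 * 'X_1)).
Qed.

Lemma rho1_u : rho (1 : k) su = 'X_0. Proof. by rewrite rho_u scale1r. Qed.

Lemma rho1_fibre : rho (1 : k) =1 fibre (oner_neq0 k).
Proof.
apply: SL2_hom_eq_reg => [c||||a].
- exact: etrans (SL2_lr_sc (rho 1) c) (esym (fibre_c _ c)).
- exact: etrans (rho_t 1) (esym (fibre_t _)).
- exact: etrans rho1_u (esym (fibre_u _)).
- exact: etrans (rho_x 1) (esym (etrans (fibre_x _) (mpolyC1 _ _))).
- by rewrite [X in X * a](rho_x 1) mul1r.
Qed.

Lemma rho1_ker f : rho (1 : k) f = 0 -> exists g, f = (sx - 1) * g.
Proof. by rewrite rho1_fibre => /fibre_ker; rewrite rmorph1. Qed.

Lemma rho1_j P : rho (1 : k) (jD P) = P.[1].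
Proof.
transitivity (homD (@mpolyC 2 k) 'X_0 'X_1 1 P).
  pose r : {rmorphism O -> C} := rho (1 : k).
  apply: (homD_unique (f := r \o jD)) => [c|||] /=.
  - by rewrite jDC; exact: (SL2_lr_sc (rho 1)).
  - by rewrite jD0; exact: rho1_u.
  - by rewrite jD1; exact: rho_t.
  - by rewrite jDX; exact: rho_x.
symmetry; apply: (homD_unique (f := horner_eval 1)) => [c|||].
- exact: hornerC.
- exact: hornerC.
- exact: hornerC.
- exact: hornerX.
Qed.

(** An extension and its inverse preserve the kernel [(x - 1)] of [rho 1], so [shift_fixed] applies;
    at [x = 1] the polynomials [U] and [T] give back [b]. *)
Lemma extends_jacobian (b : {lrmorphism C -> C}) :
  is_automorphism b -> extends_via (rho (1 : k)) b ->
  jacobian (b 'X_0) (b 'X_1) = 1 \/ jacobian (b 'X_0) (b 'X_1) = -1.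
Proof.
move=> [b' [bK b'K]] [al [[ga [alK gaK]] E]].
have [r [rE rx rk]] : exists r : {rmorphism O -> C}, [/\ r =1 rho 1, r sx = 1 &
    forall f, r f = 0 -> exists g, f = (sx - 1) * g].
  by exists (rho (1 : k)); split=> //; [exact: rho_x|exact: rho1_ker].
have Er f : r (al f) = b (r f) by rewrite !rE; exact: E.
have r1 : r (sx - 1) = 0 by rewrite rmorphB rx rmorph1 subrr.
have [e Ee] : exists e, al (sx - 1) = (sx - 1) * e.
  by apply: rk; rewrite Er r1 rmorph0.
have [e' Ee'] : exists e, ga (sx - 1) = (sx - 1) * e.
  by apply: rk; apply: (can_inj bK); rewrite rmorph0 -Er gaK.
have alx := shift_fixed (SL2_end_sc al) (SL2_end_sc ga) alK gaK Ee Ee'.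
have [U [T [EU ET]]] := volume_preserving (SL2_end_sc al) (SL2_end_sc ga) alK gaK alx.
suff [-> ->] : U.[1] = b 'X_0 /\ T.[1] = b 'X_1 by [].
split.
- by rewrite -rho1_j -EU -rho1_u; exact: E.
- by rewrite -rho1_j -ET -(rho_t 1); exact: E.
Qed.

End Volume.

(** * Extending automorphisms of the plane *)

Section Extend.
Variable k : fieldType.
Local Notation O := (SL2 k).
Local Notation C := (A2 k).
Local Notation D := {poly C}.
Local Notation sc := (@sc k).
Local Notation st := (@st k).
Local Notation su := (@su k).
Local Notation sx := (@sx k).
Local Notation sy := (@sy k).
Local Notation jD := (@jD k).

Definition endO (t u x y : O) (E : x * y = t * u + 1) : O -> O := homO sc E.

HB.instance Definition _ t u x y E :=
  GRing.RMorphism.copy (@endO t u x y E) (homO sc E).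

Fact endO_scalable t u x y E : scalable (@endO t u x y E).
Proof.
by move=> c f; rewrite !scale_sc rmorphM; congr (_ * _); exact: homO_c.
Qed.

HB.instance Definition _ t u x y E :=
  GRing.isScalable.Build k O O *:%R (@endO t u x y E) (@endO_scalable t u x y E).

Lemma extends_intro (b : {lrmorphism C -> C}) (al ga : {lrmorphism O -> O}) :
  cancel al ga -> cancel ga al -> al sx = sx ->
  rho 1 (al st) = b 'X_1 -> rho 1 (al su) = b 'X_0 -> extends_via (rho (1 : k)) b.
Proof.
move=> alK gaK alx Et Eu; exists al; split; first by exists ga.
pose r : {rmorphism O -> C} := rho (1 : k).
apply: (SL2_hom_eq_reg (f := r \o al) (g := b \o r)) => [c||||a].
- rewrite /= SL2_end_sc; transitivity (c%:MP : C); first exact: SL2_lr_sc (rho 1) c.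
  symmetry; rewrite -[LHS]/(b (rho 1 (sc c))) -(SL2_lr_sc (rho 1) c).
  by rewrite -sl2_alg !linearZ !rmorph1.
- by apply: etrans Et _; congr (b _); rewrite -[LHS](rho_t 1).
- by apply: etrans Eu _; congr (b _); rewrite -[LHS](rho1_u k).
- rewrite /= alx; transitivity (1 : C); first exact: rho_x.
  by symmetry; rewrite -(rmorph1 b); congr (b _); exact: rho_x.
- by rewrite /= alx [X in X * a](rho_x 1) mul1r.
Qed.

(** The extension of [b] is that of [bl] composed with the inverse of that of [l], so [b] may be
    modified by maps known to extend. *)
Lemma extends_cancel (b l bl : {lrmorphism C -> C}) : bl =1 b \o l ->
  extends_via (rho (1 : k)) l -> extends_via (rho (1 : k)) bl ->
  extends_via (rho (1 : k)) b.
Proof.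
move=> Ebl [al [[al' [alK al'K]] Eal]] [bt [[bt' [btK bt'K]] Ebt]].
exists (bt \o al'); split.
  exists (al \o bt'); split=> f /=; first by rewrite btK al'K.
  by rewrite alK bt'K.
move=> f; have := Ebt (al' f) => /= ->; rewrite Ebl /=.
by have := Eal (al' f) => /= <-; rewrite al'K.
Qed.

Lemma shear_endE (q : O) : sx * (sy + st * q) = st * (su + sx * q) + 1.
Proof. by rewrite !mulrDr sxy addrAC mulrCA. Qed.

(** The row operation adding [q] times the row [(x, t)] to the row [(u, y)]. *)
Definition shear_end (q : O) : {lrmorphism O -> O} := endO (shear_endE q).

Lemma shear_end_c q c : shear_end q (sc c) = sc c. Proof. exact: homO_c. Qed.
Lemma shear_end_t q : shear_end q st = st. Proof. exact: homO_t. Qed.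
Lemma shear_end_u q : shear_end q su = su + sx * q. Proof. exact: homO_u. Qed.
Lemma shear_end_x q : shear_end q sx = sx. Proof. exact: homO_x. Qed.

Lemma shear_endK q q' : q + q' = 0 -> shear_end q q' = q' ->
  cancel (shear_end q') (shear_end q).
Proof.
move=> qq fix_q; apply: (SL2_hom_id (f := shear_end q \o shear_end q')) => [c|||] /=.
- by rewrite !shear_end_c.
- by rewrite !shear_end_t.
- rewrite shear_end_u.
  transitivity (shear_end q su + shear_end q sx * shear_end q q').
    by rewrite rmorphD rmorphM.
  by rewrite fix_q shear_end_u shear_end_x -addrA -mulrDr qq mulr0 addr0.
- by rewrite !shear_end_x.
Qed.

Lemma plane_end0 (f g : C) : plane_end f g 'X_0 = f. Proof. exact: hom2X0. Qed.
Lemma plane_end1 (f g : C) : plane_end f g 'X_1 = g. Proof. exact: hom2X1. Qed.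
Lemma plane_endC (f g : C) c : plane_end f g c%:MP = c%:MP. Proof. exact: hom2C. Qed.

Lemma lrmorph_C (b : {lrmorphism C -> C}) c : b c%:MP = c%:MP.
Proof. by rewrite -[c%:MP]mulr1 mul_mpolyC linearZ rmorph1. Qed.

Lemma plane_end_unique (b : {lrmorphism C -> C}) : b =1 plane_end (b 'X_0) (b 'X_1).
Proof. by move=> p; apply: hom2_unique => //; exact: lrmorph_C. Qed.

Lemma plane_end_comp (b : {lrmorphism C -> C}) f g p :
  b (plane_end f g p) = plane_end (b f) (b g) p.
Proof.
by apply: (hom2_comp (i' := @mpolyC 2 k) _ _ (f := b)) => c; exact: lrmorph_C.
Qed.

Lemma plane_end_shear (f g : C) a c :
  plane_end f g ('X_0 + a%:MP + c%:MP * 'X_1) = f + a%:MP + c%:MP * g.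
Proof.
transitivity (plane_end f g 'X_0 + plane_end f g a%:MP +
    plane_end f g c%:MP * plane_end f g 'X_1).
  by rewrite !rmorphD rmorphM.
by rewrite !plane_endC plane_end0 plane_end1.
Qed.

Lemma extends_shear a c :
  extends_via (rho (1 : k)) (plane_end ('X_0 + a%:MP + c%:MP * 'X_1) 'X_1).
Proof.
(* At [x = 1] the row operation is [u -> u + a + c t]. As [q] involves only [t], the operation fixes
   it, and [- q] gives the inverse. *)
pose q : O := sc a + sc c * st.
have fq q' : shear_end q' q = q.
  transitivity (shear_end q' (sc a) + shear_end q' (sc c) * shear_end q' st).
    by rewrite /q rmorphD rmorphM.
  by rewrite !shear_end_c shear_end_t.
apply: (@extends_intro _ (shear_end q) (shear_end (- q))).
- by apply: shear_endK; [exact: addNr|exact: fq].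
- apply: shear_endK; first exact: subrr.
  by apply: etrans (rmorphN _ _) _; congr (- _); exact: fq.
- exact: shear_end_x.
- by rewrite shear_end_t plane_end1; exact: rho_t.
- rewrite shear_end_u plane_end0 /q.
  transitivity (rho 1 su + rho 1 sx * (rho 1 (sc a) + rho 1 (sc c) * rho 1 st)).
    by rewrite rmorphD rmorphM rmorphD rmorphM.
  rewrite rho1_u rho_x rho_t !(SL2_lr_sc (rho 1)) mul1r.
  by rewrite addrA.
Qed.

Definition swap_end : {lrmorphism O -> O} := endO (swapE k).

Lemma extends_swap : extends_via (rho (1 : k)) (plane_end 'X_1 'X_0).
Proof.
apply: (@extends_intro _ swap_end swap_end).
- exact: swapOK.
- exact: swapOK.
- exact: swapO_x.
- rewrite plane_end1 -[X in rho _ X]/(swapO k st) swapO_t; exact: rho1_u.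
- rewrite plane_end0 -[X in rho _ X]/(swapO k su) swapO_u; exact: rho_t.
Qed.

Local Notation Ext f g := (extends_via (rho (1 : k)) (plane_end f g)).
Local Notation Aut f g := (is_automorphism (plane_end f g)).

Lemma ext_shear (f g : C) a c : Ext (f + a%:MP + c%:MP * g) g -> Ext f g.
Proof.
apply: extends_cancel (extends_shear a c) => p /=.
by rewrite [RHS]plane_end_comp plane_end_shear plane_end1.
Qed.

Lemma ext_swap (f g : C) : Ext g f -> Ext f g.
Proof.
apply: extends_cancel extends_swap => p /=.
rewrite [RHS]plane_end_comp.
by rewrite plane_end0 plane_end1.
Qed.

Lemma aut_comp (b l bl : {lrmorphism C -> C}) : bl =1 b \o l ->
  is_automorphism b -> is_automorphism l -> is_automorphism bl.
Proof.
move=> E [b' [bK b'K]] [l' [lK l'K]]; exists (l' \o b'); split=> p /=.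
- by rewrite E /= bK lK.
- by rewrite E /= l'K b'K.
Qed.

Lemma aut_shear (f g : C) a c : Aut f g -> Aut (f + a%:MP + c%:MP * g) g.
Proof.
move=> A; apply: (aut_comp (l := plane_end ('X_0 + a%:MP + c%:MP * 'X_1) 'X_1)) A _.
  move=> p /=; by rewrite [RHS]plane_end_comp plane_end_shear plane_end1.
have K a1 c1 a2 c2 : a1 + a2 = 0 -> c1 + c2 = 0 ->
    cancel (plane_end ('X_0 + a1%:MP + c1%:MP * 'X_1) 'X_1)
      (plane_end ('X_0 + a2%:MP + c2%:MP * 'X_1 : C) 'X_1).
  move=> Ea Ec p; rewrite [LHS]plane_end_comp plane_end_shear plane_end1.
  rewrite -[RHS](hom2_id p); congr (plane_end _ _ p).
  transitivity ('X_0 + (a1 + a2)%:MP + (c1 + c2)%:MP * 'X_1 : C).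
    by rewrite !mpolyCD; ring.
  by rewrite Ea Ec mpolyC0 mul0r !addr0.
exists (plane_end ('X_0 + (- a)%:MP + (- c)%:MP * 'X_1) 'X_1).
by split; apply: K; rewrite ?subrr ?addNr.
Qed.

Lemma aut_swap (f g : C) : Aut f g -> Aut g f.
Proof.
move=> A; apply: (aut_comp (l := plane_end 'X_1 'X_0)) A _.
  move=> p /=; rewrite [RHS]plane_end_comp.
  by rewrite plane_end0 plane_end1.
have K : cancel (plane_end 'X_1 'X_0) (plane_end 'X_1 ('X_0 : C)).
  move=> p; rewrite [LHS]plane_end_comp.
  by rewrite plane_end0 plane_end1; exact: hom2_id.
by exists (plane_end 'X_1 'X_0).
Qed.

Lemma aut_inverse (f g : C) : Aut f g -> exists f' g',
  [/\ hom2 (@mpolyC 2 k) f g f' = 'X_0, hom2 (@mpolyC 2 k) f g g' = 'X_1,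
      hom2 (@mpolyC 2 k) f' g' f = 'X_0 & hom2 (@mpolyC 2 k) f' g' g = 'X_1].
Proof.
move=> [psi [K K']]; exists (psi 'X_0), (psi 'X_1); split.
- exact: K'.
- exact: K'.
- rewrite -[LHS]/(plane_end (psi 'X_0) (psi 'X_1) f) -plane_end_unique.
  by rewrite -{1}(plane_end0 f g) K.
- rewrite -[LHS]/(plane_end (psi 'X_0) (psi 'X_1) g) -plane_end_unique.
  by rewrite -{1}(plane_end1 f g) K.
Qed.

End Extend.

(** The product case of [scaling_jet]: expansions to first order in [x] multiply by the Leibniz
    rule. *)
Lemma jet_mul (R : comNzRingType) (u v l m x r s : R) :
  (u + x * l + x ^+ 2 * r) * (v + x * m + x ^+ 2 * s) =
  u * v + x * (v * l + u * m) +
  x ^+ 2 * (l * m + u * s + v * r + x * (l * s + m * r) + x ^+ 2 * r * s).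
Proof. by ring. Qed.

(** * Automorphisms tangent to the identity, and reduction to them *)

Section Scaling.
Variable k : fieldType.
Local Notation O := (SL2 k).
Local Notation C := (A2 k).
Local Notation D := {poly C}.
Local Notation sc := (@sc k).
Local Notation st := (@st k).
Local Notation su := (@su k).
Local Notation sx := (@sx k).
Local Notation sy := (@sy k).
Local Notation jD := (@jD k).
Local Notation Ext f g := (extends_via (rho (1 : k)) (plane_end f g)).
Local Notation Aut f g := (is_automorphism (plane_end f g)).

Definition at0 : {rmorphism C -> k} := meval (fun=> 0).
Definition lin i (f : C) : k := at0 (mderiv i f).

Lemma at0C c : at0 c%:MP = c. Proof. exact: mevalC. Qed.
Lemma at0X i : at0 'X_i = 0. Proof. exact: mevalXU. Qed.
Lemma linD i f g : lin i (f + g) = lin i f + lin i g.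
Proof. by rewrite /lin mderivD rmorphD. Qed.
Lemma linM i f g : lin i (f * g) = lin i f * at0 g + at0 f * lin i g.
Proof. by rewrite /lin mderivM rmorphD !rmorphM. Qed.
Lemma linC i c : lin i c%:MP = 0.
Proof. by rewrite /lin mderivC rmorph0. Qed.
Lemma linX i (j : 'I_2) : lin i 'X_j = (i == j)%:R.
Proof. by rewrite /lin mderiv_X; case: (i == j); rewrite ?rmorph1 ?rmorph0. Qed.

Lemma at0_hom2 f g p : at0 f = 0 -> at0 g = 0 -> at0 (hom2 (@mpolyC 2 k) f g p) = at0 p.
Proof.
move=> f0 g0; rewrite (hom2_comp (i' := idfun)) => [|c]; last exact: at0C.
rewrite f0 g0; symmetry; apply: (hom2_unique (f := at0)) => [c||].
- exact: at0C.
- exact: at0X.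
- exact: at0X.
Qed.

Lemma lin_hom2 i f g p : at0 f = 0 -> at0 g = 0 ->
  lin i (hom2 (@mpolyC 2 k) f g p) = lin 0 p * lin i f + lin 1 p * lin i g.
Proof.
move=> f0 g0.
rewrite /lin (hom2_chain f g (@mderivD _ _ i) (@mderivM _ _ i) (fun c => mderivC i c)).
rewrite (rmorphD at0) !(rmorphM at0); congr (_ * _ + _ * _); exact: at0_hom2.
Qed.

Definition scaling : {rmorphism C -> D} :=
  hom2 (@polyD k) (('X_0)%:P * 'X) (('X_1)%:P * 'X).

Lemma scaling_jet f : exists R, scaling f =
  (at0 f)%:MP%:P + 'X * ((lin 0 f)%:MP * 'X_0 + (lin 1 f)%:MP * 'X_1)%:P + 'X^2 * R.
Proof.
elim/A2_ind: f => [c|||p q [r Er] [s Es]|p q [r Er] [s Es]].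
- exists 0; rewrite !linC at0C mpolyC0 !mul0r addr0 polyC0 !mulr0 !addr0.
  exact: hom2C.
- exists 0; rewrite !linX at0X /= mpolyC0 polyC0 add0r mulr0 addr0 mpolyC1 mul1r mul0r addr0.
  by apply: etrans (hom2X0 _ _ _) _; exact: mulrC.
- exists 0; rewrite !linX at0X /= mpolyC0 polyC0 add0r mulr0 addr0 mpolyC1 mul1r mul0r add0r.
  by apply: etrans (hom2X1 _ _ _) _; exact: mulrC.
- exists (r + s); rewrite rmorphD Er Es rmorphD !linD !(mpolyCD, polyCD, polyCM).
  by ring.
- move: (linM 0 p q) (linM 1 p q) (rmorphM at0 p q) Er Es => -> -> ->.
  rewrite rmorphM; move: (at0 p) (at0 q) => a b.
  have -> (c d c' d' : k) : (c * b + a * d)%:MP * 'X_0 + (c' * b + a * d')%:MP * 'X_1 =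
      b%:MP * (c%:MP * 'X_0 + c'%:MP * 'X_1) + a%:MP * (d%:MP * 'X_0 + d'%:MP * 'X_1) :> C.
    by rewrite !mpolyCD !mpolyCM; ring.
  move: ((lin 0 p)%:MP * 'X_0 + (lin 1 p)%:MP * 'X_1 : C) => lp.
  move: ((lin 0 q)%:MP * 'X_0 + (lin 1 q)%:MP * 'X_1 : C) => lq -> ->.
  eexists; rewrite polyCD mpolyCM !polyCM; exact: jet_mul.
Qed.

Lemma scaling_1 f : (scaling f).[1] = f.
Proof.
transitivity (hom2 (@mpolyC 2 k) 'X_0 'X_1 f); last exact: hom2_id.
apply: (hom2_unique (f := horner_eval 1 \o scaling)) => [c||].
- by transitivity (c%:MP%:P : D).[1]; [congr _.[1]; exact: hom2C|exact: hornerC].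
- transitivity ((('X_0)%:P * 'X : D).[1]); first by congr _.[1]; exact: hom2X0.
  by rewrite hornerM hornerC hornerX mulr1.
- transitivity ((('X_1)%:P * 'X : D).[1]); first by congr _.[1]; exact: hom2X1.
  by rewrite hornerM hornerC hornerX mulr1.
Qed.

Definition tangent_id (f g : C) :=
  [/\ at0 f = 0, at0 g = 0, lin 0 f = 1 /\ lin 1 f = 0 & lin 0 g = 0 /\ lin 1 g = 1].

(* Division by [x] is possible because [f] and [g] vanish at the origin, and the
   result lifts to [SL2] because it is the identity at [x = 0]. *)
Lemma scaled_endo f g : tangent_id f g -> exists U T, exists al : {lrmorphism O -> O},
  [/\ 'X * U = scaling f, 'X * T = scaling g, al su = jD U, al st = jD T & al sx = sx].
Proof.
move=> [f0 g0 [f1 f2] [g1 g2]].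
have [R1 E1] := scaling_jet f; have [R2 E2] := scaling_jet g.
rewrite f0 f1 f2 mpolyC0 polyC0 mpolyC1 mul1r mul0r add0r addr0 in E1.
rewrite g0 g1 g2 mpolyC0 polyC0 mpolyC1 mul1r mul0r !add0r in E2.
pose U : D := ('X_0)%:P + 'X * R1; pose T : D := ('X_1)%:P + 'X * R2.
have EU : 'X * U = scaling f by rewrite E1 /U mulrDr mulrA.
have ET : 'X * T = scaling g by rewrite E2 /T mulrDr mulrA.
exists U, T.
have JU : jD U = su + sx * jD R1 by rewrite (rmorphD jD) (rmorphM jD) jD0 jDX.
have JT : jD T = st + sx * jD R2
  by rewrite (rmorphD jD) (rmorphM jD); congr (_ + _ * _); [exact: jD1|exact: jDX].
(* The image of [y] comes from expanding [(t + x r2) (u + x r1) + 1], replacing [t u + 1] by [x y]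
   and dividing by [x]. *)
have E : sx * (sy + st * jD R1 + su * jD R2 + sx * (jD R1 * jD R2)) = jD T * jD U + 1.
  rewrite JU JT; move: (jD R1) (jD R2) => r1 r2.
  transitivity (sx * sy + sx * (st * r1 + su * r2 + sx * (r1 * r2))); first by ring.
  by rewrite sxy; ring.
exists (endO E); split=> //.
- exact: homO_u.
- exact: homO_t.
- exact: homO_x.
Qed.

(** The map [h] sends [x u] and [x t] to [scaling f] and [scaling g], hence [scaling p] to the
    scaling of [p] composed with [(f, g)]. Take [p = f'] and [p = g'] and cancel [x]. *)
Lemma scaled_inverse f g f' g' U T U' T' :
  hom2 (@mpolyC 2 k) f g f' = 'X_0 -> hom2 (@mpolyC 2 k) f g g' = 'X_1 ->
  'X * U = scaling f -> 'X * T = scaling g -> 'X * U' = scaling f' -> 'X * T' = scaling g' ->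
  homD (@polyD k) U T 'X U' = ('X_0)%:P /\ homD (@polyD k) U T 'X T' = ('X_1)%:P.
Proof.
move=> Ef Eg EU ET EU' ET'.
have X0 : 'X != 0 :> D by rewrite polyX_eq0.
pose h : {rmorphism D -> D} := homD (@polyD k) U T 'X.
have hX : h 'X = 'X by exact: homD_X.
have h0 : h ('X_0)%:P = U by exact: etrans (homD_C _ _ _ _ _) (hom2X0 _ _ _).
have h1 : h ('X_1)%:P = T by exact: etrans (homD_C _ _ _ _ _) (hom2X1 _ _ _).
have hc c : h (polyD k c) = polyD k c.
  by exact: etrans (homD_C _ _ _ _ _) (hom2C _ _ _ _).
change (h U' = ('X_0)%:P /\ h T' = ('X_1)%:P); clearbody h.
have hf : h (('X_0)%:P * 'X) = scaling f by rewrite rmorphM h0 hX -EU; exact: mulrC.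
have hg : h (('X_1)%:P * 'X) = scaling g by rewrite rmorphM h1 hX -ET; exact: mulrC.
have key p : h (scaling p) = scaling (hom2 (@mpolyC 2 k) f g p).
  transitivity (hom2 (@polyD k) (scaling f) (scaling g) p).
    rewrite -hf -hg; exact: hom2_comp.
  by symmetry; apply: hom2_comp => c; exact: hom2C.
split; apply: (mulfI X0).
- rewrite -{1}hX -rmorphM EU' key Ef; apply: etrans (hom2X0 _ _ _) _; exact: mulrC.
- rewrite -{1}hX -rmorphM ET' key Eg; apply: etrans (hom2X1 _ _ _) _; exact: mulrC.
Qed.

Lemma extends_tangent_id f g : Aut f g -> tangent_id f g -> Ext f g.
Proof.
move=> A tfg; have [f' [g' [Ef Eg Ef' Eg']]] := aut_inverse A.
have [f0 g0 [f1 f2] [g1 g2]] := tfg.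
(* The inverse is again tangent to the identity, so it can be scaled too and yields the inverse of
   [al]. *)
have tfg' : tangent_id f' g'.
  have L i p : lin i (hom2 (@mpolyC 2 k) f g p) = lin 0 p * lin i f + lin 1 p * lin i g.
    exact: lin_hom2.
  have L0 p : lin 0 (hom2 (@mpolyC 2 k) f g p) = lin 0 p.
    by rewrite L f1 g1 mulr1 mulr0 addr0.
  have L1 p : lin 1 (hom2 (@mpolyC 2 k) f g p) = lin 1 p.
    by rewrite L f2 g2 mulr1 mulr0 add0r.
  split; [| |split|split].
  - by rewrite -(at0_hom2 _ f0 g0) Ef at0X.
  - by rewrite -(at0_hom2 _ f0 g0) Eg at0X.
  - by rewrite -L0 Ef linX.
  - by rewrite -L1 Ef linX.
  - by rewrite -L0 Eg linX.
  - by rewrite -L1 Eg linX.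
have [U [T [al [EU ET alu alt alx]]]] := scaled_endo tfg.
have [U' [T' [ga [EU' ET' gau gat gax]]]] := scaled_endo tfg'.
have comp (a b : {lrmorphism O -> O}) V W V' W' : a su = jD V -> a st = jD W -> a sx = sx ->
    b su = jD V' -> b st = jD W' -> b sx = sx ->
    homD (@polyD k) V W 'X V' = ('X_0)%:P -> homD (@polyD k) V W 'X W' = ('X_1)%:P ->
    cancel b a.
  move=> au at_ ax bu bt bx HV HW.
  apply: (SL2_hom_id (f := a \o b)) => [c|||] /=.
  - by rewrite !SL2_end_sc.
  - by rewrite bt (restrict_subring (SL2_end_sc a) ax _ au at_) HW jD1.
  - by rewrite bu (restrict_subring (SL2_end_sc a) ax _ au at_) HV jD0.
  - by rewrite bx ax.
have [H1 H2] := scaled_inverse Ef Eg EU ET EU' ET'.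
have [H1' H2'] := scaled_inverse Ef' Eg' EU' ET' EU ET.
apply: (@extends_intro _ _ al ga).
- exact: comp gau gat gax alu alt alx H1' H2'.
- exact: comp alu alt alx gau gat gax H1 H2.
- exact: alx.
- rewrite alt plane_end1; apply: etrans (rho1_j T) _.
  by rewrite -[RHS](scaling_1 g) -ET hornerM hornerX mul1r.
- rewrite alu plane_end0; apply: etrans (rho1_j U) _.
  by rewrite -[RHS](scaling_1 f) -EU hornerM hornerX mul1r.
Qed.

Lemma lin_shear i (f g : C) a c :
  lin i (f + a%:MP + c%:MP * g) = lin i f + c * lin i g.
Proof. by rewrite !linD linM !linC at0C addr0 mul0r add0r. Qed.

Definition lindet (f g : C) := lin 0 f * lin 1 g - lin 1 f * lin 0 g.

Lemma lindet_shear f g a c : lindet (f + a%:MP + c%:MP * g) g = lindet f g.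
Proof. by rewrite /lindet !lin_shear; ring. Qed.

Lemma lindet_swap f g : lindet g f = - lindet f g.
Proof. by rewrite /lindet; ring. Qed.

Lemma at0_shear (f g : C) a c : at0 (f + a%:MP + c%:MP * g) = at0 f + a + c * at0 g.
Proof. by rewrite !rmorphD rmorphM !at0C. Qed.

(** Translations make the origin fixed; the swaps bring [g] to the first place, where [ext_shear]
    acts. *)
Lemma extends_linear_id f g : Aut f g ->
  lin 0 f = 1 /\ lin 1 f = 0 -> lin 0 g = 0 /\ lin 1 g = 1 -> Ext f g.
Proof.
move=> A Lf Lg; apply: (@ext_shear _ f g (- at0 f) 0); apply: ext_swap.
apply: (@ext_shear _ g _ (- at0 g) 0); apply: ext_swap.
apply: extends_tangent_id; first exact/aut_swap/aut_shear/aut_swap/aut_shear.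
by split; rewrite ?at0_shear ?lin_shear !mul0r ?addr0 ?subrr.
Qed.

(** Gaussian elimination on the linear part with pivot [lin 0 f]: clear [lin 0 g], read off
    [lin 1 g' = 1] from the determinant, then clear [lin 1 f]. *)
Lemma extends_lin00 f g : Aut f g -> lindet f g = 1 -> lin 0 f = 1 -> Ext f g.
Proof.
move=> A d1 f1; apply: ext_swap; apply: (@ext_shear _ g f 0 (- lin 0 g)); apply: ext_swap.
set g' := g + _ + _.
have A' : Aut f g' by apply/aut_swap/aut_shear/aut_swap.
have g0 : lin 0 g' = 0 by rewrite lin_shear f1 mulr1 subrr.
have d' : lindet f g' = 1 by rewrite lindet_swap lindet_shear lindet_swap opprK.
have g1 : lin 1 g' = 1 by rewrite -d' /lindet f1 g0 mul1r mulr0 subr0.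
apply: (@ext_shear _ f g' 0 (- lin 1 f)).
apply: extends_linear_id; [exact: aut_shear| |by []].
by rewrite !(lin_shear _ f g') g0 g1 f1 mulr0 addr0 mulr1 subrr.
Qed.

Lemma extends_lin10 f g : Aut f g -> lindet f g = 1 -> lin 0 g != 0 -> Ext f g.
Proof.
(* This multiple of [g] turns the pivot [lin 0 f] into 1. *)
move=> A d1 g0; apply: (@ext_shear _ f g 0 ((1 - lin 0 f) / lin 0 g)).
apply: extends_lin00; first exact: aut_shear.
  by rewrite lindet_shear.
by rewrite lin_shear divfK // addrC subrK.
Qed.

Lemma extends_lindet1 f g : Aut f g -> lindet f g = 1 -> Ext f g.
Proof.
move=> A d1; have [g0|] := eqVneq (lin 0 g) 0; last exact: extends_lin10.
have f0 : lin 0 f != 0.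
  apply: contra_eq_neq d1 => f0; rewrite /lindet f0 g0 mul0r mulr0 subrr eq_sym.
  exact: oner_neq0.
apply: ext_swap; apply: (@ext_shear _ g f 0 1); apply: ext_swap.
apply: extends_lin10; first exact/aut_swap/aut_shear/aut_swap.
- by rewrite lindet_swap lindet_shear lindet_swap opprK.
- by rewrite lin_shear g0 add0r mul1r.
Qed.

(** The value of the Jacobian at the origin is the determinant of the linear part; a swap of the
    coordinates turns -1 into 1. *)
Lemma jacobian_extends f g : Aut f g -> jacobian f g = 1 \/ jacobian f g = -1 -> Ext f g.
Proof.
move=> A J.
have Ed : at0 (jacobian f g) = lindet f g.
  by rewrite /jacobian rmorphB !rmorphM.
case: J => J; rewrite J in Ed.
- by apply: extends_lindet1; rewrite // -Ed rmorph1.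
- apply: ext_swap; apply: extends_lindet1; first exact: aut_swap.
  by rewrite lindet_swap -Ed rmorphN rmorph1 opprK.
Qed.

End Scaling.

(** * Embeddings with the same image *)

Section Kernels.
Variable k : fieldType.
Local Notation O := (SL2 k).
Local Notation C := (A2 k).
Local Notation st := (@st k).
Local Notation su := (@su k).
Local Notation sx := (@sx k).

Definition hom_ker (A B : comAlgType k) (r : {lrmorphism A -> B}) : pred A :=
  fun f => r f == 0.

Section KernelIdeal.
Variables (A : comAlgType k) (r : {lrmorphism A -> C}).

Fact hom_ker_ideal : idealr_closed (hom_ker r).
Proof.
split; rewrite /in_mem /= /hom_ker ?rmorph0 ?rmorph1 ?oner_eq0 // => a u v /eqP ru /eqP rv.
have {}ru : r u = 0 by []; have {}rv : r v = 0 by [].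
by apply/eqP; rewrite rmorphD rmorphM; rewrite [X in _ * X]ru [X in _ + X]rv mulr0 addr0.
Qed.

Fact hom_ker_prime : prime_idealr_closed (hom_ker r).
Proof.
by move=> u v; rewrite /in_mem /= /hom_ker rmorphM mulf_eq0.
Qed.

HB.instance Definition _ := isIdealr.Build A (hom_ker r) hom_ker_ideal.
HB.instance Definition _ := isPrimeIdealrClosed.Build A (hom_ker r) hom_ker_prime.
End KernelIdeal.

(** The kernel of [r'] is the generic point of its image, so it is contracted along [r] from a
    prime, and such a contraction contains the kernel of [r]. *)
Lemma same_image_ker (r r' : {lrmorphism O -> C}) f :
  same_image r r' -> r f = 0 -> r' f = 0.
Proof.
move=> S rf.
have /S [P HP] : in_image r' (hom_ker r').
  by exists (hom_ker (idfun : {lrmorphism C -> C})).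
have := HP f; rewrite rf rpred0 => r'f.
by move/eqP: r'f.
Qed.

(** * Dilations of the plane and the embeddings [rho lam] *)

Definition dil (a : k) : {lrmorphism C -> C} := plane_end (a *: 'X_0) 'X_1.

Lemma dil0 a : dil a 'X_0 = a *: 'X_0. Proof. exact: plane_end0. Qed.
Lemma dil1 a : dil a 'X_1 = 'X_1. Proof. exact: plane_end1. Qed.

Lemma dilM a b p : dil a (dil b p) = dil (a * b) p.
Proof.
rewrite [LHS]plane_end_comp linearZ /=.
by rewrite [plane_end _ _ 'X_0]plane_end0 [plane_end _ _ 'X_1]plane_end1 scalerA mulrC.
Qed.

Lemma dil_id p : dil 1 p = p.
Proof. by apply: etrans (hom2_id p); rewrite /dil scale1r. Qed.

Lemma dil_aut a : a != 0 -> is_automorphism (dil a).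
Proof.
by move=> a0; exists (dil a^-1); split=> p; rewrite dilM ?mulVf ?mulfV // dil_id.
Qed.

Lemma jacobian_dil a f g : jacobian (a *: f) g = a%:MP * jacobian f g :> C.
Proof. by rewrite /jacobian !mderivZ mul_mpolyC scalerBr !scalerAl. Qed.

Lemma jacobian_X : jacobian 'X_0 'X_1 = 1 :> C.
Proof. by rewrite /jacobian !mderiv_X /= !mulr0 mulr1 subr0. Qed.

Lemma rho_dil lam f : rho lam f = dil lam (rho 1 f).
Proof.
pose r : {rmorphism O -> C} := rho (1 : k); pose r' : {rmorphism O -> C} := rho lam.
apply: (SL2_hom_eq_reg (f := r') (g := dil lam \o r)) => [c||||a].
- transitivity (c%:MP : C); first exact: SL2_lr_sc (rho lam) c.
  symmetry; apply: etrans (lrmorph_C (dil lam) c); congr (dil lam _).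
  exact: SL2_lr_sc (rho 1) c.
- apply: etrans (rho_t lam) _; symmetry; apply: etrans (dil1 lam); congr (dil lam _).
  exact: rho_t.
- apply: etrans (rho_u lam) _; symmetry; apply: etrans (dil0 lam); congr (dil lam _).
  exact: rho1_u.
- apply: etrans (rho_x lam) _; symmetry; apply: etrans (rmorph1 (dil lam)).
  congr (dil lam _); exact: rho_x.
- by rewrite [X in X * a](rho_x lam) mul1r.
Qed.

Lemma extends_jacobianP (f g : C) : is_automorphism (plane_end f g) ->
  extends_via (rho (1 : k)) (plane_end f g) <-> jacobian f g = 1 \/ jacobian f g = -1.
Proof.
move=> A; split; last exact: jacobian_extends.
by move/(extends_jacobian A); rewrite plane_end0 plane_end1.
Qed.

Lemma extends_dil a : a != 0 ->
  extends_via (rho (1 : k)) (dil a) <-> a = 1 \/ a = -1.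
Proof.
move=> a0; apply: iff_trans (extends_jacobianP (dil_aut a0)) _.
rewrite jacobian_dil jacobian_X mulr1.
have E b : (a%:MP = b%:MP :> C) <-> a = b.
  by split=> [/eqP|-> //]; rewrite mpolyC_eq => /eqP.
have := E 1; have := E (-1); rewrite mpolyCN mpolyC1; tauto.
Qed.

(** By [rho_dil], composing both embeddings with the dilation by [lam^-1] replaces [rho lam] by
    [rho 1]; the same [al] serves both sides. *)
Lemma equivalent_dil (lam lam' : k) : lam != 0 ->
  equivalent (rho lam) (rho lam') <-> extends_via (rho (1 : k)) (dil (lam^-1 * lam')).
Proof.
move=> l0; split=> -[al [A E]]; exists al; (split; first exact: A) => f /=.
- rewrite -dilM -rho_dil; have /= -> := E f.
  by rewrite [X in _ = dil _ X]rho_dil dilM mulVf // dil_id.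
- rewrite [LHS]rho_dil [RHS]rho_dil; have /= -> := E f.
  by rewrite dilM mulrA mulfV // mul1r.
Qed.

Lemma equivalent_rho (lam lam' : k) : lam != 0 -> lam' != 0 ->
  equivalent (rho lam) (rho lam') <-> lam' = lam \/ lam' = - lam.
Proof.
move=> l0 l'0; apply: iff_trans (equivalent_dil _ l0) _.
apply: iff_trans (extends_dil _) _; first by rewrite mulf_neq0 ?invr_neq0.
have E b : lam^-1 * lam' = b <-> lam' = lam * b.
  by split=> [<-|->]; rewrite mulrA ?mulfV ?mulVf // mul1r.
by have := E 1; have := E (-1); rewrite mulrN mulr1; tauto.
Qed.

(** Equal images give equal kernels, so [r x = 1] and [r] factors as [b] after [rho 1]. Then [b] is
    injective by the equality of kernels and surjective because [r] is. *)
Lemma embedding_factor (r : {lrmorphism O -> C}) :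
  closed_embedding r -> same_image r (rho 1) ->
  exists f g f' g', [/\ r =1 plane_end f g \o rho 1,
    cancel (plane_end f g) (plane_end f' g') & cancel (plane_end f' g') (plane_end f g)].
Proof.
move=> surj S.
have S' : same_image (rho 1) r by move=> Q; apply: iff_sym (S Q).
pose b : {lrmorphism C -> C} := plane_end (r su) (r st).
pose r1 : {rmorphism O -> C} := rho (1 : k).
have rx : r sx = 1.
  apply/eqP; rewrite -subr_eq0 -(rmorph1 r) -rmorphB; apply/eqP.
  apply: same_image_ker S' _; rewrite rmorphB rmorph1; apply/eqP; rewrite subr_eq0.
  by apply/eqP; exact: rho_x.
have Eb : r =1 b \o rho 1.
  move=> f; symmetry; apply: (SL2_hom_eq_reg (f := b \o r1) (g := r)) => [c||||a].
  - rewrite [RHS](SL2_lr_sc r); apply: etrans (lrmorph_C b c); congr (b _).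
    exact: SL2_lr_sc (rho 1) c.
  - by apply: etrans (plane_end1 (r su) (r st)); congr (b _); exact: rho_t.
  - by apply: etrans (plane_end0 (r su) (r st)); congr (b _); exact: rho1_u.
  - by rewrite [RHS]rx; apply: etrans (rmorph1 b); congr (b _); exact: rho_x.
  - have bx : (b \o r1) sx = 1 by apply: etrans (rmorph1 b); congr (b _); exact: rho_x.
    by rewrite [X in X * a]bx mul1r.
have b_inj : injective b.
  move=> p q /eqP; rewrite -subr_eq0 -rmorphB => /eqP bpq; apply/eqP.
  rewrite -subr_eq0; apply/eqP.
  have [f Ef] := rho_closed_embedding (oner_neq0 k) (p - q).
  by rewrite -Ef in bpq *; apply: same_image_ker S _; rewrite Eb.
(* Preimages of the two coordinates under [r], restricted by [rho 1], define the inverse of [b]. *)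
have [f0 Ef0] := surj 'X_0; have [g0 Eg0] := surj 'X_1.
exists (r su), (r st), (rho 1 f0), (rho 1 g0).
have K : cancel (plane_end (rho 1 f0) (rho 1 g0)) b.
  move=> p; apply: etrans (hom2_id p).
  rewrite [LHS]plane_end_comp; congr (plane_end _ _ p).
  - by rewrite -Ef0 Eb.
  - by rewrite -Eg0 Eb.
split; [exact: Eb| |exact: K].
by move=> p; apply: b_inj; rewrite [LHS]K.
Qed.

(** A dilation by [c^-1] normalizes the Jacobian of the inverse plane automorphism to 1, so the
    corrected map extends; the dilation left over gives [rho c^-1]. *)
Lemma embedding_equivalent (r : {lrmorphism O -> C}) :
  closed_embedding r -> same_image r (rho 1) ->
  exists2 lam : k, lam != 0 & equivalent r (rho lam).
Proof.
move=> surj S; have [f [g [f' [g' [Er bK bK']]]]] := embedding_factor surj S.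
have A' : is_automorphism (plane_end f' g').
  exists (plane_end f g); split; [exact: bK'|exact: bK].
have [c c0 Jc] : exists2 c, c != 0 & jacobian f' g' = c%:MP.
  have [p [q [Ep Eq _ _]]] := aut_inverse A'; exact: jacobian_unit Ep Eq.
have ci0 : c^-1 != 0 by rewrite invr_neq0.
have Edil : plane_end (c^-1 *: f') g' =1 plane_end f' g' \o dil c^-1.
  move=> p /=; rewrite plane_end_comp linearZ /=.
  by rewrite [plane_end _ _ 'X_0]plane_end0 [plane_end _ _ 'X_1]plane_end1.
have [al [alA E]] : extends_via (rho (1 : k)) (plane_end (c^-1 *: f') g').
  apply: jacobian_extends; first exact: aut_comp Edil A' (dil_aut ci0).
  by left; rewrite jacobian_dil Jc -mpolyCM mulVf // mpolyC1.
exists c^-1 => //; exists al; split=> // h /=.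
have := E h => /= Eh; rewrite Er /= Eh Edil /= bK'; exact: rho_dil.
Qed.

End Kernels.

Theorem theorem2 (k : fieldType) :
  (forall f g : A2 k, is_automorphism (plane_end f g) ->
     (exists2 c : k, c != 0 & jacobian f g = c%:MP) /\
     (extends_via (rho (1 : k)) (plane_end f g) <->
        jacobian f g = 1 \/ jacobian f g = -1)) /\
  (forall r : {lrmorphism SL2 k -> A2 k},
     closed_embedding r -> same_image r (rho 1) ->
     exists2 lam : k, lam != 0 & equivalent r (rho lam)) /\
  (forall lam lam' : k, lam != 0 -> lam' != 0 ->
     (equivalent (rho lam) (rho lam') <-> lam' = lam \/ lam' = - lam)) /\
  ((exists s : seq k, uniq s /\ (4 <= size s)%N) ->
     ~ (forall b : {lrmorphism A2 k -> A2 k},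
          is_automorphism b -> extends_via (rho (1 : k)) b)).
Proof.
split; [|split; [|split]].
- move=> f g A; split; last exact: extends_jacobianP.
  by have [p [q [Ep Eq _ _]]] := aut_inverse A; exact: jacobian_unit Ep Eq.
- exact: embedding_equivalent.
- exact: equivalent_rho.
- move=> [s [us s4]] H.
  (* Four distinct scalars cannot all lie in a list of length 3; the dilation by one outside it does
     not extend. *)
  have /allPn[c _] : ~~ all (fun c => c \in [:: 0; 1; -1]) s.
    apply/negP => /allP sub; have := uniq_leq_size us sub; move: s4 => /=.
    by move=> s4 /(leq_trans s4).
  rewrite !inE !negb_or => /and3P[c0 c1 cN1].
  by have /(extends_dil c0)[E|E] := H _ (dil_aut c0); rewrite E eqxx in c1 cN1.
Qed.
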